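(* Let $((A,\rho_A);(B,\rho_B))$ be an $E$-Lie bialgebroid. Then $(A\oplus B,(\cdot,\cdot)_E,[\cdot,\cdot]_{A\oplus B},\rho_A+\rho_B)$ is an $E$-Courant algebroid, where for $X_i\in\Gamma(A)$, $\xi_i\in\Gamma(B)$, $$(X_1+\xi_1,X_2+\xi_2)_E=\tfrac12(\langle X_1,\xi_2\rangle_E+\langle X_2,\xi_1\rangle_E),$$ $$[X_1+\xi_1,X_2+\xi_2]_{A\oplus B}=[X_1,X_2]+\mathcal L_{\xi_1}X_2-\mathcal L_{\xi_2}X_1+d^B\langle X_1,\xi_2\rangle_E+[\xi_1,\xi_2]+\mathcal L_{X_1}\xi_2-\mathcal L_{X_2}\xi_1+d^A\langle X_2,\xi_1\rangle_E.$$
   Context: **Bundles.** $\mathfrak DE$ is the gauge Lie algebroid of $E\to M$: its sections are the $\mathbb R$-linear $\mathfrak d:\Gamma(E)\to\Gamma(E)$ for which there is a vector field $j(\mathfrak d)$ with $\mathfrak d(fu)=f\mathfrak d(u)+j(\mathfrak d)(f)u$; bracket $[\cdot,\cdot]_{\mathfrak D}$ = commutator, anchor $j$. The first jet bundle $\mathfrak JE$ is regarded as $\{\nu\in\mathrm{Hom}(\mathfrak DE,E):\nu(\Psi)=\Psi(\nu(\mathrm{Id}_E))\ \forall\Psi\in\mathfrak{gl}(E)\}$, the jet $[u]_m$ corresponding to $\mathfrak d\mapsto\mathfrak d(u)(m)$; $\mathbf d:\Gamma(E)\to\Gamma(\mathfrak JE)$, $(\mathbf du)(\mathfrak d)=\mathfrak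 d(u)$. **$E$-Courant algebroids.** A Leibniz algebra has a bilinear bracket with $[g_1,[g_2,g_3]]=[[g_1,g_2],g_3]+[g_2,[g_1,g_3]]$. An $E$-Courant algebroid is $(\mathcal K,(\cdot,\cdot)_E,[\cdot,\cdot]_{\mathcal K},\rho)$: $\mathcal K\to M$ a vector bundle with $(\Gamma(\mathcal K),[\cdot,\cdot]_{\mathcal K})$ a Leibniz algebra over $\mathbb R$; $(\cdot,\cdot)_E:\mathcal K\otimes\mathcal K\to E$ symmetric nondegenerate; $\rho:\mathcal K\to\mathfrak DE$ a bundle map; with $\rho^\star(\nu)(k)=\nu(\rho(k))$, for all sections: (EC-1) $\rho[X,Y]_{\mathcal K}=[\rho(X),\rho(Y)]_{\mathfrak D}$; (EC-2) $[X,X]_{\mathcal K}=\rho^\star\mathbf d(X,X)_E$; (EC-3) $\rho(X)(Y,Z)_E=([X,Y]_{\mathcal K},Z)_E+(Y,[X,Z]_{\mathcal K})_E$; (EC-4) $\rho^\star(\mathfrak JE)\subset\mathcal K$, where $\rho^\star(\mu)$ is identified with the element of $\mathcal K$ satisfying $(\rho^\star(\mu),X)_E=\tfrac12\mu(\rho(X))$; (EC-5) $\rho\circ\rho^\star=0$ on $\mathfrak JE$. **$E$-duality.** A subbundle $B\subset\mathrm{Hom}(A,E)$ is an $E$-dual bundle of $A$ if the pairing $\langle a,b\rangle_E=b(a)$ is nondegenerate (on both sides); then also $A\subset\mathrm{Hom}(B,E)$. Set $\mathrm{Hom}(\wedge^0A,E)_B=E$, $\mathrm{Hom}(\wedge^1A,E)_B=B$,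 and for $k\ge2$ let $\mathrm{Hom}(\wedge^kA,E)_B$ consist of the $\mu\in\mathrm{Hom}(\wedge^kA,E)$ with $\mu(X_1,\dots,X_{k-1},\cdot)\in B$ for all $X_i$; similarly $\mathrm{Hom}(\wedge^kB,E)_A$. If $A$ is a Lie algebroid with representation $\rho_A:A\to\mathfrak DE$, $d^A$ is the Chevalley–Eilenberg coboundary on $\Gamma(\mathrm{Hom}(\wedge^\bullet A,E))$; $\rho_A$ is $B$-invariant if $\Gamma(\mathrm{Hom}(\wedge^\bullet A,E)_B)$ is a subcomplex. An $E$-dual pair of Lie algebroids $((A,\rho_A);(B,\rho_B))$ consists of Lie algebroids $A,B$ that are mutually $E$-dual, a $B$-invariant representation $\rho_A:A\to\mathfrak DE$ and an $A$-invariant representation $\rho_B:B\to\mathfrak DE$. **Lie derivatives.** For $X,Y\in\Gamma(A)$, $\xi\in\Gamma(B)$: $\mathcal L_Xu=\rho_A(X)u$, $\mathcal L_XY=[X,Y]$, $\langle\mathcal L_X\xi,Y\rangle_E=\rho_A(X)\langle\xi,Y\rangle_E-\langle\xi,[X,Y]\rangle_E$, and for $\Xi\in\Gamma(\mathrm{Hom}(\wedge^kB,E)_A)$, $(\mathcal L_X\Xi)(\xi_1,\dots,\xi_k)=\rho_A(X)(\Xi(\xi_1,\dots,\xi_k))-\sum_i\Xi(\xi_1,\dots,\mathcal L_X\xi_i,\dots,\xi_k)$; analogously for $\mathcal L_\xi$, exchanging $A$ and $B$. **$E$-Lie bialgebroid.** An $E$-dual pair such that for all $X,Y\in\Gamma(A)$,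 $u\in\Gamma(E)$: (1) $d^B[X,Y]=\mathcal L_X(d^BY)-\mathcal L_Y(d^BX)$; (2) $\mathcal L_{d^Au}X=-\mathcal L_{d^Bu}X$; (3) $\langle d^Bu,d^Au\rangle_E=0$. (Here $d^Au\in\Gamma(B)$, $d^Bu\in\Gamma(A)$.) *)

(* Defs.v *)
From HB Require Import structures.
From mathcomp Require Import all_boot all_order all_algebra.
From mathcomp Require Import all_classical all_reals all_analysis.
Set Implicit Arguments.
Unset Strict Implicit.
Unset Printing Implicit Defensive.
Import Order.TTheory GRing.Theory Num.Theory numFieldNormedType.Exports.
Local Open Scope classical_set_scope.
Local Open Scope ring_scope.

(* [Ck k U f]: f is of class C^k on U; only meaningful for U open.  In finite
   dimension, C^k-ness of every x |-> 'D_v f x is C^k-ness of the differential. *)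
Fixpoint Ck (R : realType) (V W : normedModType R) (k : nat) (U : set V)
    (f : V -> W) : Prop :=
  if k is k'.+1 then
    (forall x, U x -> differentiable f x) /\
    (forall v : V, Ck k' U (fun x => 'D_v f x))
  else forall x, U x -> {for x, continuous f}.

Definition smooth_on (R : realType) (V W : normedModType R) (U : set V)
    (f : V -> W) : Prop := forall k, Ck k U f.

Section CkTheory.
Context {R : realType} {V W : normedModType R}.
Implicit Types (U : set V) (f g : V -> W).

Lemma near_eq_differentiable f g (x : V) :
  (\near x, f x = g x) -> differentiable f x -> differentiable g x.
Proof.
move=> fg df.
have fgx : f x = g x by exact: nbhs_singleton fg.
have fg0 : \forall y \near (0 : V), f (y + x) = g (y + x).
  by move: fg; rewrite (near_shift 0 x) /= subr0.
have eg : g \o shift x = cst (g x) + 'd f x +o_ 0 id.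
  apply/eqaddoP => e e0.
  have /eqaddoP/(_ e e0) := diff_locally df.
  apply: filterS2 fg0 => y /= fgy.
  by rewrite /GRing.add /GRing.opp /= -fgy fgx.
have ed := diff_unique (diff_continuous df) eg.
by apply/diff_locallyP; rewrite ed; split => //; exact: diff_continuous.
Qed.

Lemma Ck_ext k U f g : open U -> (forall x, U x -> f x = g x) ->
  Ck k U f -> Ck k U g.
Proof.
move=> oU; elim: k f g => [|k IH] f g fg /=.
  move=> cf x Ux.
  have nfg : {near x, f =1 g}.
    by apply: filterS (open_nbhs_nbhs (conj oU Ux)) => y /fg.
  rewrite /prop_for /continuous_at -(fg _ Ux).
  by apply: cvg_trans (cf _ Ux); exact: near_eq_cvg.
move=> [df cf]; split.
  move=> x Ux; apply: near_eq_differentiable (df _ Ux).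
  by apply: filterS (open_nbhs_nbhs (conj oU Ux)) => y /fg.
move=> v; apply: IH (cf v) => x Ux; apply: near_eq_derive.
by apply: filterS (open_nbhs_nbhs (conj oU Ux)) => y /fg.
Qed.

Lemma Ck_sub k U U' f : U' `<=` U -> Ck k U f -> Ck k U' f.
Proof.
move=> UU'; elim: k f => [|k IH] f /=; first by move=> cf x /UU'; exact: cf.
by move=> [df cf]; split=> [x /UU'|v]; [exact: df|exact: IH].
Qed.

Lemma Ck_local k U f : (forall x, U x -> exists W, W x /\ Ck k W f) ->
  Ck k U f.
Proof.
elim: k f => [|k IH] f /= loc; first by move=> x /loc[U' [U'x]]; exact.
split=> [x /loc[U' [U'x [df _]]]|v]; first exact: df.
by apply: IH => x /loc[U' [U'x [_ cf]]]; exists U'.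
Qed.

Lemma CkS k U f : Ck k.+1 U f -> Ck k U f.
Proof.
elim: k f => [|k IH] f /=.
  by move=> [df _] x /df; exact: differentiable_continuous.
by move=> [df cf]; split=> // v; exact: (IH _ (cf v)).
Qed.

Lemma Ck_cst k U (c : W) : Ck k U (fun=> c).
Proof.
elim: k c => [|k IH] c /=; first by move=> x _; exact: cvg_cst.
split=> [x _|v]; first exact: differentiable_cst.
have -> : (fun x : V => 'D_v (fun=> c) x) = fun=> 0; last exact: IH.
by apply/funext => x; exact: derive_cst.
Qed.

Lemma CkD k U f g : open U -> Ck k U f -> Ck k U g -> Ck k U (f \+ g).
Proof.
move=> oU; elim: k f g => [|k IH] f g /=.
  by move=> cf cg x Ux; apply: cvgD; [exact: cf|exact: cg].
move=> [df cf] [dg cg]; split=> [x Ux|v].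
  by apply: differentiableD; [exact: df|exact: dg].
apply: Ck_ext (IH _ _ (cf v) (cg v)) => // x Ux /=.
by rewrite deriveD//; apply: diff_derivable; [exact: df|exact: dg].
Qed.

End CkTheory.

Lemma CkM (R : realType) (V : normedModType R) k (U : set V) (f g : V -> R) :
  open U -> Ck k U f -> Ck k U g -> Ck k U (f \* g).
Proof.
move=> oU; elim: k f g => [|k IH] f g.
  by move=> cf cg x Ux; apply: cvgM; [exact: cf|exact: cg].
move=> fk gk; have [fk' gk'] := (CkS fk, CkS gk).
move: fk gk => [df cf] [dg cg]; split=> [x Ux|v].
  by apply: differentiableM; [exact: df|exact: dg].
apply: Ck_ext (CkD oU (IH _ _ fk' (cg v)) (IH _ _ gk' (cf v))) => // x Ux /=.
by rewrite deriveM//; apply: diff_derivable; [exact: df|exact: dg].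
Qed.

Record manifold (R : realType) (n : nat) := Manifold {
  mcarrier :> topologicalType;
  mhausdorff : hausdorff_space mcarrier;
  msecond_countable : @second_countable mcarrier;
  chart_index : Type;
  cdom : chart_index -> set mcarrier;
  cimg : chart_index -> set 'rV[R]_n;
  cmap : chart_index -> mcarrier -> 'rV[R]_n;
  cinv : chart_index -> 'rV[R]_n -> mcarrier;
  cdom_open : forall a, open (cdom a);
  cimg_open : forall a, open (cimg a);
  cdom_cover : forall m, exists a, cdom a m;
  cmap_img : forall a m, cdom a m -> cimg a (cmap a m);
  cinv_dom : forall a y, cimg a y -> cdom a (cinv a y);
  cmapK : forall a m, cdom a m -> cinv a (cmap a m) = m;
  cinvK : forall a y, cimg a y -> cmap a (cinv a y) = y;
  cmap_cont : forall a m, cdom a m -> {for m, continuous (cmap a)};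
  cinv_cont : forall a y, cimg a y -> {for y, continuous (cinv a)};
  chart_compat : forall a b,
    smooth_on [set y | cimg a y /\ cdom b (cinv a y)] (cmap b \o cinv a) }.

(* The image in the chart a of the part of U covered by it. *)
Definition chart_image (R : realType) (n : nat) (M : manifold R n)
    (U : set M) (a : chart_index M) : set 'rV[R]_n :=
  [set y | cimg a y /\ U (cinv a y)].

Definition smoothM_on (R : realType) (n : nat) (M : manifold R n) (U : set M)
    (f : M -> R) : Prop :=
  forall a : chart_index M, smooth_on (chart_image U a) (f \o cinv a).

Section SmoothFunctions.
Context {R : realType} {n : nat} {M : manifold R n}.
Implicit Types (U : set M) (f g : M -> R).

Lemma open_chart_image U a : open U -> open (chart_image U a).
Proof.
move=> oU; rewrite openE => y [ay Uy].
have nU : nbhs (cinv a y) U by exact: open_nbhs_nbhs.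
have nyU : nbhs y (cinv a @^-1` U) by exact: (cinv_cont ay).
have ny : nbhs y (cimg a) by apply: open_nbhs_nbhs; split=> //; exact: cimg_open.
exact: filterI ny nyU.
Qed.

Lemma smoothM_sub U U' f : U' `<=` U -> smoothM_on U f -> smoothM_on U' f.
Proof.
move=> UU' sf a k; apply: Ck_sub (sf a k) => y [ay Uy].
by split=> //; exact: UU'.
Qed.

Lemma smoothM_ext U f g : open U -> (forall m, U m -> f m = g m) ->
  smoothM_on U f -> smoothM_on U g.
Proof.
move=> oU fg sf a k; apply: Ck_ext (sf a k); first exact: open_chart_image.
by move=> y [_ Uy] /=; exact: fg.
Qed.

Lemma smoothM_local U f :
  (forall m, U m -> exists U', U' m /\ smoothM_on U' f) -> smoothM_on U f.
Proof.
move=> loc a k; apply: Ck_local => y [ay /loc[U' [U'y sf]]].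
by exists (chart_image U' a); split; [|exact: sf].
Qed.

Lemma smoothM_cst U (c : R) : smoothM_on U (fun=> c).
Proof. by move=> a k; exact: Ck_cst. Qed.

Lemma smoothMD U f g : open U -> smoothM_on U f -> smoothM_on U g ->
  smoothM_on U (f \+ g).
Proof.
by move=> oU sf sg a k; exact: (CkD (open_chart_image oU) (sf a k) (sg a k)).
Qed.

Lemma smoothMM U f g : open U -> smoothM_on U f -> smoothM_on U g ->
  smoothM_on U (f \* g).
Proof.
by move=> oU sf sg a k; exact: (CkM (open_chart_image oU) (sf a k) (sg a k)).
Qed.

End SmoothFunctions.

Record smooth_fun (R : realType) (n : nat) (M : manifold R n) := SmoothFun {
  sfun :> M -> R;
  sfun_smooth : smoothM_on setT sfun }.

(* A tangent vector at m, as the operator f |-> v(f): in every chart around m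
   it is a directional derivative. *)
Definition is_tangent (R : realType) (n : nat) (M : manifold R n) (m : M)
    (v : smooth_fun M -> R) : Prop :=
  forall a : chart_index M, cdom a m ->
    exists w : 'rV[R]_n, forall f, v f = 'D_w (f \o cinv a) (cmap a m).

Definition is_vector_field (R : realType) (n : nat) (M : manifold R n)
    (X : M -> smooth_fun M -> R) : Prop :=
  (forall m, is_tangent m (X m)) /\
  (forall f, smoothM_on setT (fun m => X m f)).

(* A vector bundle as a family of vector spaces with smoothly compatible local
   frames: over [bdom i], [frame i x] and [coord i x] are inverse linear
   isomorphisms between R^(brank i) and the fibre at x. *)
Record vbundle (R : realType) (n : nat) (M : manifold R n) := VBundle {
  fiber :> M -> lmodType R;
  triv_index : Type;
  bdom : triv_index -> set M;
  brank : triv_index -> nat;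
  frame : forall i x, 'rV[R]_(brank i) -> fiber x;
  coord : forall i x, fiber x -> 'rV[R]_(brank i);
  bdom_open : forall i, open (bdom i);
  bdom_cover : forall x, exists i, bdom i x;
  coord_linear : forall i x, bdom i x -> linear (@coord i x);
  frameK : forall i x, bdom i x -> cancel (@frame i x) (@coord i x);
  coordK : forall i x, bdom i x -> cancel (@coord i x) (@frame i x);
  triv_compat : forall i j (v : 'rV[R]_(brank j)) (k : 'I_(brank i)),
    smoothM_on (bdom i `&` bdom j)
      (fun x => @coord i x (@frame j x v) ord0 k) }.
Arguments frame {R n M} {E} i x v : rename.
Arguments coord {R n M} {E} i {x} a : rename.

Definition smooth_section (R : realType) (n : nat) (M : manifold R n)
    (E : vbundle M) (s : forall x, E x) : Prop :=
  forall (i : triv_index E) (k : 'I_(brank i)),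
    smoothM_on (bdom i) (fun x => coord i (s x) ord0 k).

Record section (R : realType) (n : nat) (M : manifold R n) (E : vbundle M) :=
  MkSection {
    sec :> forall x, E x;
    sec_smooth : smooth_section sec }.

HB.instance Definition _ (R : realType) (n : nat) (M : manifold R n)
  (E : vbundle M) := gen_eqMixin (section E).
HB.instance Definition _ (R : realType) (n : nat) (M : manifold R n)
  (E : vbundle M) := gen_choiceMixin (section E).

Section SectionModule.
Context {R : realType} {n : nat} {M : manifold R n} {E : vbundle M}.
Implicit Types (s t u : section E) (f : smooth_fun M).

Lemma section_eqP s t : (forall x, s x = t x) -> s = t.
Proof.
case: s t => [s ss] [t st] /= st_eq.
have e : s = t by apply: functional_extensionality_dep.
by subst t; congr MkSection; exact: Prop_irrelevance.
Qed.

Lemma coordD (i : triv_index E) x (a b : E x) : bdom i x ->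
  coord i (a + b) = coord i a + coord i b.
Proof. by move=> ix; have := coord_linear ix 1 a b; rewrite !scale1r. Qed.

Lemma coord0 (i : triv_index E) x : bdom i x -> coord i (0 : E x) = 0.
Proof.
by move=> ix; apply: (addrI (coord i (0 : E x))); rewrite -coordD// !addr0.
Qed.

Lemma coordZ (i : triv_index E) x (c : R) (a : E x) : bdom i x ->
  coord i (c *: a) = c *: coord i a.
Proof.
by move=> ix; have := coord_linear ix c a 0; rewrite coord0// !addr0.
Qed.

Lemma smooth_section0 : smooth_section (fun x => 0 : E x).
Proof.
move=> i k; apply: smoothM_ext (smoothM_cst (bdom i) 0); first exact: bdom_open.
by move=> x ix; rewrite coord0// mxE.
Qed.

Lemma smooth_sectionD s t : smooth_section (fun x => s x + t x).
Proof.
move=> i k; have oi := bdom_open i.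
apply: smoothM_ext (smoothMD oi (sec_smooth s k) (sec_smooth t k)) => // x ix.
by rewrite /= coordD// mxE.
Qed.

Lemma smooth_section_fscale f s : smooth_section (fun x => f x *: s x).
Proof.
move=> i k; have oi := bdom_open i.
have sf : smoothM_on (bdom i) f by apply: smoothM_sub (sfun_smooth f).
apply: smoothM_ext (smoothMM oi sf (sec_smooth s k)) => // x ix.
by rewrite /= coordZ// mxE.
Qed.

Definition fscale f s : section E := MkSection (smooth_section_fscale f s).

Definition csmooth (c : R) : smooth_fun M := SmoothFun (smoothM_cst setT c).

Definition section0 : section E := MkSection smooth_section0.
Definition sectionD s t : section E := MkSection (smooth_sectionD s t).
Definition sectionZ (c : R) s : section E := fscale (csmooth c) s.
Definition sectionN s : section E := sectionZ (-1) s.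

Lemma sectionDA : associative sectionD.
Proof. by move=> s t u; apply: section_eqP => x /=; rewrite addrA. Qed.
Lemma sectionDC : commutative sectionD.
Proof. by move=> s t; apply: section_eqP => x /=; rewrite addrC. Qed.
Lemma section0D : left_id section0 sectionD.
Proof. by move=> s; apply: section_eqP => x /=; rewrite add0r. Qed.
Lemma sectionND : left_inverse section0 sectionN sectionD.
Proof. by move=> s; apply: section_eqP => x /=; rewrite scaleN1r addNr. Qed.

HB.instance Definition _ := GRing.isZmodule.Build (section E)
  sectionDA sectionDC section0D sectionND.

Lemma sectionZA (a b : R) s :
  sectionZ a (sectionZ b s) = sectionZ (a * b) s.
Proof. by apply: section_eqP => x /=; rewrite scalerA. Qed.
Lemma section1Z : left_id 1 sectionZ.
Proof. by move=> s; apply: section_eqP => x /=; rewrite scale1r. Qed.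
Lemma sectionZDr : right_distributive sectionZ +%R.
Proof. by move=> c s t; apply: section_eqP => x /=; rewrite scalerDr. Qed.
Lemma sectionZDl s : {morph sectionZ^~ s : a b / a + b}.
Proof. by move=> a b; apply: section_eqP => x /=; rewrite scalerDl. Qed.

HB.instance Definition _ := GRing.Zmodule_isLmodule.Build R (section E)
  sectionZA section1Z sectionZDr sectionZDl.

Lemma sec0 x : (0 : section E) x = 0. Proof. by []. Qed.
Lemma secD s t x : (s + t) x = s x + t x. Proof. by []. Qed.
Lemma secZ (c : R) s x : (c *: s) x = c *: s x. Proof. by []. Qed.
Lemma secN s x : (- s) x = - s x. Proof. by rewrite -scaleN1r. Qed.

End SectionModule.

Section DirectSum.
Context {R : realType} {n : nat} {M : manifold R n}.
Variables A B : vbundle M.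

Let dfiber (x : M) : lmodType R := (A x * B x)%type.
Let dindex : Type := (triv_index A * triv_index B)%type.
Let ddom (i : dindex) : set M := bdom i.1 `&` bdom i.2.
Let drank (i : dindex) : nat := (brank i.1 + brank i.2)%N.
Let dframe (i : dindex) x (v : 'rV[R]_(drank i)) : dfiber x :=
  (frame i.1 x (lsubmx v), frame i.2 x (rsubmx v)).
Let dcoord (i : dindex) x (z : dfiber x) : 'rV[R]_(drank i) :=
  row_mx (coord i.1 z.1) (coord i.2 z.2).

Let ddom_open i : open (ddom i).
Proof. by apply: openI; exact: bdom_open. Qed.

Let ddom_cover x : exists i, ddom i x.
Proof.
by have [i ix] := bdom_cover A x; have [j jx] := bdom_cover B x; exists (i, j).
Qed.

Let dcoord_linear i x : ddom i x -> linear (@dcoord i x).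
Proof.
move=> [ix jx] c [a b] [a' b']; rewrite /dcoord /=.
by rewrite !coord_linear// scale_row_mx add_row_mx.
Qed.

Let dframeK i x : ddom i x -> cancel (@dframe i x) (@dcoord i x).
Proof. by move=> [ix jx] v; rewrite /dcoord /= !frameK// hsubmxK. Qed.

Let dcoordK i x : ddom i x -> cancel (@dcoord i x) (@dframe i x).
Proof.
by move=> [ix jx] [a b]; rewrite /dframe row_mxKl row_mxKr !coordK.
Qed.

Let dtriv_compat i j (v : 'rV[R]_(drank j)) (k : 'I_(drank i)) :
  smoothM_on (ddom i `&` ddom j) (fun x => @dcoord i x (@dframe j x v) ord0 k).
Proof.
rewrite -(splitK k); case: (fintype.split k) => k' /=.
- under eq_fun do rewrite /dcoord row_mxEl.
  apply: smoothM_sub (triv_compat (lsubmx v) k').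
  by move=> x [[ix _] [jx _]].
- under eq_fun do rewrite /dcoord row_mxEr.
  apply: smoothM_sub (triv_compat (rsubmx v) k').
  by move=> x [[_ ix] [_ jx]].
Qed.

Definition dsum : vbundle M :=
  VBundle ddom_open ddom_cover dcoord_linear dframeK dcoordK dtriv_compat.

Lemma smooth_dsum (s : forall x, A x) (t : forall x, B x) :
  smooth_section s -> smooth_section t ->
  smooth_section (E := dsum) (fun x => (s x, t x)).
Proof.
move=> ss st i k; rewrite -(splitK k); case: (fintype.split k) => k' /=.
- under eq_fun do rewrite /coord /= /dcoord row_mxEl.
  by apply: smoothM_sub (ss i.1 k') => x [].
- under eq_fun do rewrite /coord /= /dcoord row_mxEr.
  by apply: smoothM_sub (st i.2 k') => x [].
Qed.

End DirectSum.

Section DirectSumSections.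
Context {R : realType} {n : nat} {M : manifold R n} {A B : vbundle M}.

Definition sec_pair (X : section A) (xi : section B) : section (dsum A B) :=
  MkSection (smooth_dsum (sec_smooth X) (sec_smooth xi)).

Lemma smooth_fst (Z : section (dsum A B)) : smooth_section (fun x => (Z x).1).
Proof.
move=> i k; apply: smoothM_local => x ix; have [j jx] := bdom_cover B x.
exists (bdom i `&` bdom j); split=> //.
have := sec_smooth Z (i := (i, j)) (lshift _ k).
by under eq_fun do rewrite /coord /= row_mxEl.
Qed.

Lemma smooth_snd (Z : section (dsum A B)) : smooth_section (fun x => (Z x).2).
Proof.
move=> j k; apply: smoothM_local => x jx; have [i ix] := bdom_cover A x.
exists (bdom i `&` bdom j); split=> //.
have := sec_smooth Z (i := (i, j)) (rshift _ k).
by under eq_fun do rewrite /coord /= row_mxEr.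
Qed.

Definition sec_fst (Z : section (dsum A B)) : section A :=
  MkSection (smooth_fst Z).
Definition sec_snd (Z : section (dsum A B)) : section B :=
  MkSection (smooth_snd Z).

End DirectSumSections.

(* A bundle map A (x) B -> C. *)
Record bilmap (R : realType) (n : nat) (M : manifold R n)
    (A B C : vbundle M) := Bilmap {
  bmap :> forall m, A m -> B m -> C m;
  bmap_linearl : forall m (b : B m), linear (fun a : A m => bmap a b);
  bmap_linearr : forall m (a : A m), linear (fun b : B m => bmap a b);
  bmap_smooth : forall (X : section A) (Y : section B),
    smooth_section (fun m => bmap (X m) (Y m)) }.
Arguments bmap {R n M A B C} p m a b : rename.

Definition bsec (R : realType) (n : nat) (M : manifold R n)
    (A B C : vbundle M) (p : bilmap A B C) (X : section A) (Y : section B) :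
    section C := MkSection (bmap_smooth p X Y).

(* The sections of the gauge Lie algebroid DE. *)
Definition is_gauge (R : realType) (n : nat) (M : manifold R n)
    (E : vbundle M) (D : section E -> section E) : Prop :=
  linear D /\
  exists j : M -> smooth_fun M -> R, is_vector_field j /\
    forall (f : smooth_fun M) (u : section E) (m : M),
      D (fscale f u) m = f m *: D u m + j m f *: u m.

(* The fibre of DE at m: an element D(m), for D a section of DE, is identified
   with the operator u |-> (D u)(m), which determines it. *)
Definition DE_fiber (R : realType) (n : nat) (M : manifold R n)
    (E : vbundle M) (m : M) (d : section E -> E m) : Prop :=
  exists2 D : section E -> section E, is_gauge D & d = (fun u => D u m).

(* A bundle map K -> DE. *)
Record demap (R : realType) (n : nat) (M : manifold R n)
    (K E : vbundle M) := Demap {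
  dmap :> forall m, K m -> section E -> E m;
  dmap_linear : forall m (u : section E), linear (fun k : K m => dmap k u);
  dmap_fiber : forall m (k : K m), DE_fiber (dmap k);
  dmap_smooth : forall (X : section K) (u : section E),
    smooth_section (fun m => dmap (X m) u);
  dmap_gauge : forall X : section K,
    is_gauge (fun u => MkSection (dmap_smooth X u)) }.
Arguments dmap {R n M K E} rho m k u : rename.

Definition act (R : realType) (n : nat) (M : manifold R n) (K E : vbundle M)
    (rho : demap K E) (X : section K) (u : section E) : section E :=
  MkSection (dmap_smooth rho X u).

Section DirectSumMaps.
Context {R : realType} {n : nat} {M : manifold R n} {E A B : vbundle M}.

Definition bswap (p : bilmap A B E) : bilmap B A E :=
  Bilmap (bmap := fun m b a => p m a b)
    (fun m b => bmap_linearr p b) (fun m a => bmap_linearl p a)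
    (fun Y X => bmap_smooth p X Y).

Section HalfPairing.
Variable p : bilmap A B E.

Let hp (m : M) (z1 z2 : dsum A B m) : E m :=
  2^-1 *: (p m z1.1 z2.2 + p m z2.1 z1.2).

Let hpC m (z1 z2 : dsum A B m) : hp z1 z2 = hp z2 z1.
Proof. by rewrite /hp addrC. Qed.

Let hp_linearl m (z2 : dsum A B m) : linear (fun z1 => hp z1 z2).
Proof.
move=> c [a b] [a' b']; rewrite /hp /=.
have -> := bmap_linearl p z2.2 c a a'; have -> := bmap_linearr p z2.1 c b b'.
by rewrite addrACA !scalerDr !scalerA [c * _]mulrC.
Qed.

Let hp_linearr m (z1 : dsum A B m) : linear (fun z2 => hp z1 z2).
Proof. by move=> c z z'; rewrite ![hp z1 _]hpC hp_linearl. Qed.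

Let hp_smooth (Z1 Z2 : section (dsum A B)) :
  smooth_section (fun m => hp (Z1 m) (Z2 m)).
Proof.
exact: (sec_smooth (2^-1 *: (bsec p (sec_fst Z1) (sec_snd Z2) +
                             bsec p (sec_fst Z2) (sec_snd Z1)))).
Qed.

Definition half_pairing : bilmap (dsum A B) (dsum A B) E :=
  Bilmap hp_linearl hp_linearr hp_smooth.

End HalfPairing.

Lemma is_tangentD m (v w : smooth_fun M -> R) :
  is_tangent m v -> is_tangent m w -> is_tangent m (fun f => v f + w f).
Proof.
move=> tv tw a am; have [x vx] := tv a am; have [y wy] := tw a am.
exists (x + y) => f; rewrite vx wy.
have df : differentiable (f \o cinv a) (cmap a m).
  have [+ _] := sfun_smooth f a 1%N; apply.
  by split=> //; exact: cmap_img.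
by rewrite !deriveE// linearD.
Qed.

Lemma is_gaugeD (D1 D2 D : section E -> section E) :
  is_gauge D1 -> is_gauge D2 -> (forall u, D u = D1 u + D2 u) -> is_gauge D.
Proof.
move=> [l1 [j1 [[t1 s1] r1]]] [l2 [j2 [[t2 s2] r2]]] DE; split.
  by move=> c u v; rewrite !DE l1 l2 addrACA -scalerDr.
exists (fun m f => j1 m f + j2 m f); split; first split.
- by move=> m; exact: is_tangentD.
- by move=> f; exact: smoothMD openT (s1 f) (s2 f).
- move=> f u m.
  by rewrite !DE !secD r1 r2 addrACA -scalerDr -scalerDl.
Qed.

Section SumMap.
Variables (rhoA : demap A E) (rhoB : demap B E).

Let sm (m : M) (z : dsum A B m) (u : section E) : E m :=
  rhoA m z.1 u + rhoB m z.2 u.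

Let sm_linear m u : linear (fun z : dsum A B m => sm z u).
Proof.
move=> c [a b] [a' b']; rewrite /sm /=.
have -> := dmap_linear rhoA u c a a'; have -> := dmap_linear rhoB u c b b'.
by rewrite addrACA -scalerDr.
Qed.

Let sm_fiber m (z : dsum A B m) : DE_fiber (sm z).
Proof.
have [D1 g1 e1] := dmap_fiber rhoA z.1; have [D2 g2 e2] := dmap_fiber rhoB z.2.
exists (fun u => D1 u + D2 u); first exact: is_gaugeD g1 g2 _.
by apply/funext => u; rewrite /sm e1 e2.
Qed.

Let sm_smooth (Z : section (dsum A B)) u :
  smooth_section (fun m => sm (Z m) u).
Proof.
exact: (sec_smooth (act rhoA (sec_fst Z) u + act rhoB (sec_snd Z) u)).
Qed.

Let sm_gauge (Z : section (dsum A B)) :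
  is_gauge (fun u => MkSection (sm_smooth Z u)).
Proof.
apply: is_gaugeD (dmap_gauge rhoA (sec_fst Z)) (dmap_gauge rhoB (sec_snd Z)) _.
by move=> u; apply: section_eqP.
Qed.

Definition sum_map : demap (dsum A B) E :=
  Demap sm_linear sm_fiber sm_gauge.

End SumMap.

End DirectSumMaps.

Record lie_algebroid (R : realType) (n : nat) (M : manifold R n)
    (A : vbundle M) := LieAlgebroid {
  la_br :> section A -> section A -> section A;
  la_linearl : forall Y, linear (fun X => la_br X Y);
  la_linearr : forall X, linear (fun Y => la_br X Y);
  la_alt : forall X, la_br X X = 0;
  la_jacobi : forall X Y Z,
    la_br X (la_br Y Z) = la_br (la_br X Y) Z + la_br Y (la_br X Z);
  anchor : forall m, A m -> smooth_fun M -> R;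
  anchor_linear : forall m (f : smooth_fun M) (c : R) (a b : A m),
    anchor (c *: a + b) f = c * anchor a f + anchor b f;
  anchor_tangent : forall m (a : A m), is_tangent m (anchor a);
  anchor_smooth : forall X : section A,
    is_vector_field (fun m => anchor (X m));
  la_leibniz : forall X Y (f : smooth_fun M) m,
    la_br X (fscale f Y) m = f m *: la_br X Y m + anchor (X m) f *: Y m }.
Arguments anchor {R n M A} LA m a f : rename.

(* rho is a morphism of Lie algebroids A -> DE. *)
Definition is_representation (R : realType) (n : nat) (M : manifold R n)
    (A E : vbundle M) (LA : lie_algebroid A) (rho : demap A E) : Prop :=
  (forall (X : section A) (f : smooth_fun M) (u : section E) m,
    act rho X (fscale f u) m =
      f m *: act rho X u m + anchor LA m (X m) f *: u m) /\
  (forall (X Y : section A) (u : section E),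
    act rho (LA X Y) u = act rho X (act rho Y u) - act rho Y (act rho X u)).

Definition upd (T : Type) (k : nat) (X : 'I_k -> T) (i : 'I_k) (Y : T) :
  'I_k -> T := fun j => if j == i then Y else X j.

Section Forms.
Context {R : realType} {n : nat} {M : manifold R n} {A B E : vbundle M}.

(* Sections of Hom(/\^k A, E), as alternating C^oo(M)-multilinear maps. *)
Definition is_form (k : nat) (w : ('I_k -> section A) -> section E) : Prop :=
  (forall (X : 'I_k -> section A) (i : 'I_k) (f : smooth_fun M) (Y Z : section A),
    w (upd X i (fscale f Y + Z)) =
      fscale f (w (upd X i Y)) + w (upd X i Z)) /\
  (forall (X : 'I_k -> section A) (i j : 'I_k),
    i != j -> X i = X j -> w X = 0).

(* Sections of Hom(/\^k A, E)_B, B being embedded in Hom(A, E) by p. *)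
Definition is_form_in (p : bilmap A B E) (k : nat)
    (w : ('I_k -> section A) -> section E) : Prop :=
  is_form w /\
  forall i : 'I_k, i.+1 = k -> forall X : 'I_k -> section A,
    exists beta : section B, forall Y, w (upd X i Y) = bsec p Y beta.

Variables (LA : lie_algebroid A) (rho : demap A E).

Definition dCE (k : nat) (w : ('I_k -> section A) -> section E) :
    ('I_k.+1 -> section A) -> section E := fun X =>
  \sum_(i < k.+1) (-1) ^+ i *: act rho (X i) (w (fun l => X (lift i l))) +
  \sum_(i < k.+1) \sum_(j < k.+1 | (i < j)%N)
    (-1) ^+ (i + j) *:
      w (fun l : 'I_k =>
           nth 0 (LA (X i) (X j) ::
                  [seq X h | h <- enum 'I_k.+1 & (h != i) && (h != j)]) l).

Definition is_invariant (p : bilmap A B E) : Prop :=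
  forall (k : nat) (w : ('I_k -> section A) -> section E),
    is_form_in p w -> is_form_in p (dCE w).

Definition form0 (u : section E) : ('I_0 -> section A) -> section E :=
  fun=> u.

Definition form1 (p : bilmap A B E) (beta : section B) :
  ('I_1 -> section A) -> section E := fun X => bsec p (X ord0) beta.

(* The differential of u as a section of B; the sections of B below exist, and
   are unique, when p is nondegenerate and rho is B-invariant. *)
Definition dsec (p : bilmap A B E) (u : section E) : section B :=
  xget 0 [set beta | form1 p beta = dCE (form0 u)].

Definition lie (p : bilmap A B E) (X : section A) (xi : section B) :
    section B :=
  xget 0 [set eta | forall Y : section A,
    bsec p Y eta = act rho X (bsec p Y xi) - bsec p (LA X Y) xi].

Definition lie_form (p : bilmap A B E) (X : section A) (k : nat)
    (Xi : ('I_k -> section B) -> section E) :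
    ('I_k -> section B) -> section E := fun xi =>
  act rho X (Xi xi) - \sum_(i < k) Xi (upd xi i (lie p X (xi i))).

End Forms.

Section Bialgebroid.
Context {R : realType} {n : nat} {M : manifold R n} {E A B : vbundle M}.

(* p embeds each of A and B in the bundle of homomorphisms from the other to E. *)
Definition E_dual (p : bilmap A B E) : Prop :=
  (forall m (a : A m), (forall b, p m a b = 0) -> a = 0) /\
  (forall m (b : B m), (forall a, p m a b = 0) -> b = 0).

Variables (LA : lie_algebroid A) (LB : lie_algebroid B) (p : bilmap A B E).
Variables (rhoA : demap A E) (rhoB : demap B E).

Record is_E_dual_pair : Prop := {
  edp_dual : E_dual p;
  edp_repA : is_representation LA rhoA;
  edp_repB : is_representation LB rhoB;
  edp_invA : is_invariant LA rhoA p;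
  edp_invB : is_invariant LB rhoB (bswap p) }.

Record is_E_Lie_bialgebroid : Prop := {
  elb_pair : is_E_dual_pair;
  elb_compat : forall (X Y : section A) (xi : 'I_2 -> section B),
    dCE LB rhoB (form1 (bswap p) (LA X Y)) xi =
      lie_form LA rhoA p X (dCE LB rhoB (form1 (bswap p) Y)) xi -
      lie_form LA rhoA p Y (dCE LB rhoB (form1 (bswap p) X)) xi;
  elb_lie : forall (u : section E) (X : section A),
    lie LB rhoB (bswap p) (dsec LA rhoA p u) X =
      - LA (dsec LB rhoB (bswap p) u) X;
  elb_isotropic : forall u : section E,
    bsec p (dsec LB rhoB (bswap p) u) (dsec LA rhoA p u) = 0 }.

Definition double_bracket (Z1 Z2 : section (dsum A B)) : section (dsum A B) :=
  let dA := dsec LA rhoA p in let dB := dsec LB rhoB (bswap p) in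
  let lieA := lie LA rhoA p in let lieB := lie LB rhoB (bswap p) in
  let X1 := sec_fst Z1 in let xi1 := sec_snd Z1 in
  let X2 := sec_fst Z2 in let xi2 := sec_snd Z2 in
  sec_pair
    (LA X1 X2 + lieB xi1 X2 - lieB xi2 X1 + dB (bsec p X1 xi2))
    (LB xi1 xi2 + lieA X1 xi2 - lieA X2 xi1 + dA (bsec p X2 xi1)).

End Bialgebroid.

Section Courant.
Context {R : realType} {n : nat} {M : manifold R n} {K E : vbundle M}.

(* The fibre of JE at m, inside Hom(DE, E); nu is only relevant on the fibre
   of DE at m. *)
Definition JE_fiber (m : M) (nu : (section E -> E m) -> E m) : Prop :=
  (forall (c : R) (d d' : section E -> E m), DE_fiber d -> DE_fiber d' ->
    nu (fun u => c *: d u + d' u) = c *: nu d + nu d') /\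
  (forall Psi : {linear E m -> E m},
    nu (fun u => Psi (u m)) = Psi (nu (fun u => u m))).

(* The value at m of the section d u of JE. *)
Definition jet (u : section E) (m : M) : (section E -> E m) -> E m :=
  fun d => d u.

Variables (ip : bilmap K K E) (br : section K -> section K -> section K).
Variable rho : demap K E.

(* k is the element of K identified with rho^*(nu). *)
Definition is_rho_star (m : M) (nu : (section E -> E m) -> E m) (k : K m) :
  Prop := forall x : K m, ip m k x = 2^-1 *: nu (rho m x).

Record is_E_Courant : Prop := {
  ec_linearl : forall Y, linear (fun X => br X Y);
  ec_linearr : forall X, linear (fun Y => br X Y);
  ec_leibniz : forall X Y Z, br X (br Y Z) = br (br X Y) Z + br Y (br X Z);
  ec_sym : forall m (k k' : K m), ip m k k' = ip m k' k;
  ec_nondegenerate : forall m (k : K m),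
    (forall k', ip m k k' = 0) -> k = 0;
  ec_1 : forall X Y u,
    act rho (br X Y) u = act rho X (act rho Y u) - act rho Y (act rho X u);
  ec_2 : forall (X : section K) m,
    is_rho_star (jet (bsec ip X X) (m := m)) (br X X m);
  ec_3 : forall X Y Z,
    act rho X (bsec ip Y Z) = bsec ip (br X Y) Z + bsec ip Y (br X Z);
  ec_4 : forall m (nu : (section E -> E m) -> E m), JE_fiber nu ->
    exists k : K m, is_rho_star nu k;
  ec_5 : forall m (nu : (section E -> E m) -> E m) (k : K m),
    JE_fiber nu -> is_rho_star nu k -> rho m k = (fun=> 0) }.

End Courant.

(* Main.v *)
Require Import Defs.
From HB Require Import structures.
From mathcomp Require Import all_boot all_order all_algebra.
From mathcomp Require Import all_classical all_reals all_analysis.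
From mathcomp Require Import ring.
Set Implicit Arguments.
Unset Strict Implicit.
Unset Printing Implicit Defensive.
Import Order.TTheory GRing.Theory Num.Theory numFieldNormedType.Exports.
Local Open Scope classical_set_scope.
Local Open Scope ring_scope.

(** Write q for twice the pairing of the double, r = rho_A + rho_B for its anchor
    and D u = d^B u + d^A u, so that q (D u, Z) = r(Z) u.  Invariance of the two
    representations guarantees that d^A, d^B and the Lie derivatives exist as
    sections and are characterized by their pairings ([bsec_dsec], [bsec_lie]).

    The axioms on sections all come from four identities.  The anchor r acts on q
    by derivations, by the definition of the Lie derivatives
    ([double_anchor_pairing]).  The symmetric part of the bracket is D q
    ([double_bracket_sym]).  The bracket of D u with anything vanishes
    ([double_d_bracket]): its two components are [elb_lie] and the dual of
    [elb_lie], which follows from it by pairing.  Finally r preserves brackets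
    ([double_anchor_bracket]); for an element of A and one of B this is again
    [elb_lie], together with r (D u) = 0, which is [elb_isotropic] polarized
    ([anchor_d]).

    These identities imply, for any bracket, that q (J(x, y, z), w) is totally
    antisymmetric, J being the defect of the Leibniz identity
    ([jacobiator_anti12], [jacobiator_anti23], [jacobiator_anti34]).  It therefore
    vanishes if it does with three arguments in A or three in B, which are the
    Jacobi identities of A and B, and with two arguments in each, which is
    [elb_compat] read on a pair of sections of B ([double_jacobi_AABB]).

    The axioms on jets are fibrewise.  Passing from sections to fibres uses bump
    functions, built here from t^-k e^(-1/t): every vector extends to a global
    section ([section_through]).  Moreover every element of the fibre of the jet
    bundle is the jet of a section ([JE_fiber_jet]); in the double it is represented
    by D u, and r (D u) = 0 then gives [ec_5]. *)

(** * Smooth functions of a real variable that are flat at the origin *)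

Section FlatFunction.
Context {R : realType}.
Implicit Types (t : R) (k : nat).

(** The functions t^-k e^(-1/t), extended by zero to t <= 0, form a family closed under
    differentiation up to linear combinations, so that smoothness of all its
    members can be proved by a single induction on the order. *)
Definition flat k t : R := if 0 < t then t ^- k * expR (- t^-1) else 0.

Lemma flat_le0 k t : t <= 0 -> flat k t = 0.
Proof. by rewrite /flat leNgt; case: ltP. Qed.

Lemma flat_gt0 k t : 0 < t -> 0 < flat k t.
Proof. by move=> t0; rewrite /flat t0 mulr_gt0 ?expR_gt0 ?invr_gt0 ?exprn_gt0. Qed.

(** The exponential beats every power: e^x dominates x^(k+2) / (k+2)!, taken at
    x = 1/t.  Quadratic decay gives a zero derivative at the origin. *)
Lemma flat_quadratic k t : `|flat k t| <= k.+2`!%:R * t ^+ 2.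
Proof.
have [t0|t0] := leP t 0; first by rewrite flat_le0// normr0 mulr_ge0 ?sqr_ge0.
rewrite gtr0_norm ?flat_gt0// /flat t0 expRN.
have i0 : 0 < t^-1 by rewrite invr_gt0.
have h : t^-1 ^+ k.+2 / k.+2`!%:R <= expR t^-1.
  by apply: le_trans (expR_ge1Dxn k.+1 (ltW i0)); rewrite lerDr ler01.
have f0 : (0 : R) < k.+2`!%:R by rewrite ltr0n fact_gt0.
have p0 : 0 < t^-1 ^+ k.+2 / k.+2`!%:R by rewrite divr_gt0// exprn_gt0.
apply: (@le_trans _ _ (t ^- k * (t^-1 ^+ k.+2 / k.+2`!%:R)^-1)).
  by rewrite ler_pM2l ?invr_gt0 ?exprn_gt0// lef_pV2// posrE ?expR_gt0.
by rewrite invf_div exprVn invrK mulrCA -addn2 exprD mulKf ?expf_neq0 ?gt_eqF.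
Qed.

Lemma is_derive_quadratic (f : R -> R) (C : R) :
  (forall t, `|f t| <= C * t ^+ 2) -> is_derive (0 : R) (1 : R) f 0.
Proof.
move=> fC.
have f0 : f 0 = 0.
  by apply/eqP; rewrite -normr_le0 (le_trans (fC _))// expr0n mulr0.
have C0 : 0 <= C by rewrite -[C]mulr1 -(expr1n R 2) (le_trans _ (fC 1)).
have lim0 : (h^-1 *: (f (h *: (1 : R) + 0) - f 0)) @[h --> 0^'] --> (0 : R).
  apply/cvgr0Pnorm_le => e e0.
  near=> h.
  have hn0 : h != 0 by near: h; exact: nbhs_dnbhs_neq.
  rewrite f0 subr0 addr0 normrZ normfV.
  rewrite [h *: 1]mulr1 ler_pdivrMl ?normr_gt0//.
  rewrite (le_trans (fC h))// -real_normK ?num_real// expr2 mulrA mulrC.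
  rewrite ler_pM2l ?normr_gt0//.
  have : `|h| <= e / (C + 1).
    by near: h; apply: dnbhs0_le; rewrite divr_gt0// ltr_wpDl.
  rewrite ler_pdivlMr ?ltr_wpDl// mulrDr mulr1 mulrC => h1.
  by rewrite (le_trans _ h1)// lerDl.
apply: DeriveDef; first by apply/cvg_ex; exists 0.
exact/cvg_lim.
Unshelve. all: by end_near. Qed.

Lemma is_derive_flat k t :
  is_derive t (1 : R) (flat k) (flat k.+2 t - k%:R * flat k.+1 t).
Proof.
have [t0|t0|->] := ltgtP t 0.
- rewrite !flat_le0 ?ltW// mulr0 subr0.
  apply: near_eq_is_derive (is_derive_cst 0 t 1).
  by apply: filterS (lt_nbhsl t0) => x x0; rewrite flat_le0 ?ltW.
- rewrite /flat t0.
  apply: (@near_eq_is_derive _ _ _ (fun t => t^-1 ^+ k * expR (- t^-1))).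
    by apply: filterS (lt_nbhsr t0) => x x0; rewrite x0 exprVn.
  have tn0 : t != 0 by rewrite gt_eqF.
  pose inv (s : R) := s^-1.
  have dV : is_derive t (1 : R) inv (- t ^- 2).
    apply: DeriveDef.
      by apply: (@derivableV _ _ id t 1 tn0); exact: derivable_id.
    by rewrite (@deriveV _ _ id t 1 tn0 (@derivable_id _ _ t 1)) derive_id [_ *: _]mulr1.
  have dX := is_deriveX k dV.
  have dE : is_derive t (1 : R) (expR \o (- inv)) (expR (- t^-1) * t ^- 2).
    have := @is_derive1_comp _ expR (- inv) t _ _ (is_derive_expR _) (is_deriveN dV).
    by rewrite opprK.
  have dM := is_deriveM dX dE.
  have -> : (fun s => s^-1 ^+ k * expR (- s^-1)) = (inv ^+ k) * (expR \o (- inv)).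
    by apply/funext => s; rewrite /GRing.mul /= exprfctE.
  case: dM => dM1 dM2; apply: DeriveDef; first exact: dM1.
  rewrite dM2 {dM1 dM2}.
  rewrite exprfctE /= /inv /GRing.scale /= -!exprVn.
  set e := expR _; set s := t^-1.
  case: k {dX} => [|k] /=; first by rewrite !mul0r subr0 mulr0 addr0 expr0 mul1r mulrC.
  by rewrite !exprS; ring.
- rewrite !flat_le0 ?ltxx// mulr0 subr0.
  exact: is_derive_quadratic (@flat_quadratic k).
Qed.

Lemma Ck_flat j k : Ck j setT (flat k).
Proof.
elim: j k => [|j IH] k /=.
  move=> t _; apply: differentiable_continuous; apply/derivable1_diffP.
  by case: (is_derive_flat k t).
have df t : differentiable (flat k) t.
  by apply/derivable1_diffP; case: (is_derive_flat k t).
split=> [t _|v]; first exact: df.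
pose d t := v * (flat k.+2 t + (- k%:R) * flat k.+1 t).
have -> : (fun t => 'D_v (flat k) t) = d.
  apply/funext => t; rewrite deriveE// -[X in 'd _ _ X]mulr1 [LHS]linearZ /=.
  rewrite -deriveE//; have -> := @derive_val _ _ _ _ _ _ _ (is_derive_flat k t).
  by rewrite /d mulNr.
have cst c : Ck j (setT : set R) (fun=> c : R) by exact: Ck_cst.
have t1 := CkM openT (cst (- k%:R)) (IH k.+1).
have t2 := CkM openT (cst v) (CkD openT (IH k.+2) t1).
apply: Ck_ext t2; [exact: openT|by []].
Qed.

End FlatFunction.

(** * Composition and coordinates of C^k functions *)

Section CkComposition.
Context {R : realType} {V : normedModType R}.

(** The differential of a scalar function is multiplication by its derivative,
    so the chain rule only involves products of functions to which the induction
    hypothesis applies. *)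
Lemma Ck_comp1 k (U : set V) (f : R -> R) (h : V -> R) : open U ->
  (forall j, Ck j setT f) -> Ck k U h -> Ck k U (f \o h).
Proof.
move=> oU; elim: k f => [|k IH] f sf.
  move=> ch x Ux; apply: continuous_comp; first exact: ch.
  exact: (sf 0%N).
move=> hk; have hk' := CkS hk; move: hk => [dh ch].
have [df _] := sf 1%N.
split=> [x Ux|v]; first by apply: differentiable_comp; [exact: dh|exact: df].
have sf' : forall j, Ck j setT (fun t => 'D_1 f t).
  by move=> j; have [_] := sf j.+1; apply.
apply: Ck_ext (CkM oU (ch v) (IH _ sf' hk')) => // x Ux /=.
have dfh : differentiable f (h x) by exact: df.
have dhx := dh _ Ux; have dfhx := differentiable_comp dhx dfh.
rewrite !deriveE// (diff_comp dhx dfh) /=.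
by rewrite -['d h x v in RHS]mulr1 [RHS]linearZ.
Qed.

Lemma Ck_coord k n (U : set V) (f : V -> 'rV[R]_n) i : open U ->
  Ck k U f -> Ck k U (fun x => f x ord0 i).
Proof.
move=> oU; elim: k f => [|k IH] f /=.
  move=> cf x Ux; apply: (@continuous_comp _ _ _ f (fun y : 'rV_n => y ord0 i)).
    exact: cf.
  exact: coord_continuous.
move=> [df cf]; split=> [x Ux|v].
  apply: (@differentiable_comp _ _ _ _ f (fun y : 'rV_n => y ord0 i)).
    exact: df.
  exact: differentiable_coord.
apply: Ck_ext (IH _ (cf v)) => // x Ux.
by rewrite derive_mx ?mxE//; apply: diff_derivable; exact: df.
Qed.

End CkComposition.

(** * Bump functions on manifolds *)

Section Bump.
Context {R : realType} {n : nat} {M : manifold R n}.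
Implicit Types (U : set M) (f : M -> R).

Lemma smoothM_comp1 U (h : R -> R) f : open U ->
  (forall j, Ck j setT h) -> smoothM_on U f -> smoothM_on U (h \o f).
Proof.
by move=> oU sh sf a k; exact: Ck_comp1 (open_chart_image oU) sh (sf a k).
Qed.

Lemma smoothM_sum (I : Type) (s : seq I) U (F : I -> M -> R) : open U ->
  (forall i, smoothM_on U (F i)) -> smoothM_on U (fun x => \sum_(i <- s) F i x).
Proof.
move=> oU sF; elim: s => [|i s IH].
  by under eq_fun do rewrite big_nil; exact: smoothM_cst.
under eq_fun do rewrite big_cons.
exact: smoothMD oU (sF i) IH.
Qed.

Lemma smoothM_chart_coord (a : chart_index M) (l : 'I_n) :
  smoothM_on (cdom a) (fun x => cmap a x ord0 l).
Proof.
move=> b k; have := chart_compat b a k.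
by move=> /(Ck_coord l)H; apply: H; exact: open_chart_image (cdom_open a).
Qed.

(** The support is recorded through a closed subset of U outside which the
    function vanishes: products with functions smooth on U only are then smooth
    on all of M. *)
Record cutoff U (m : M) := Cutoff {
  cutoff_fun :> smooth_fun M;
  cutoff_supp : set M;
  cutoff1 : cutoff_fun m = 1;
  cutoff_closed : closed cutoff_supp;
  cutoff_sub : cutoff_supp `<=` U;
  cutoff0 : forall x, ~ cutoff_supp x -> cutoff_fun x = 0 }.

(** The bump is a flat function of r^2 - |x - y0|^2 read in a chart, divided by
    its value at the centre.  Its support is the image of a compact ball, hence
    compact, and therefore closed because M is Hausdorff: this is what makes the
    extension by zero smooth. *)
Lemma cutoff_exists U (m : M) : open U -> U m -> inhabited (cutoff U m).
Proof.
move=> oU Um; have [a am] := cdom_cover m.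
pose y0 := cmap a m.
have oW : open (chart_image U a) by exact: open_chart_image.
have Wy0 : chart_image U a y0 by split; [exact: cmap_img|rewrite /y0 cmapK].
have /nbhs_closedballP[r rW] : nbhs y0 (chart_image U a).
  exact: open_nbhs_nbhs.
set K := closed_ball y0 r%:num in rW.
pose C := cinv a @` K.
have CU : C `<=` U by move=> _ [y Ky <-]; have [] := rW _ Ky.
have Ca : C `<=` cdom a.
  by move=> _ [y Ky <-]; apply: cinv_dom; have [] := rW _ Ky.
have KE y : K y = (`|y0 - y| <= r%:num) :> Prop.
  by rewrite /K closed_ballE.
have cK : compact K.
  apply: bounded_closed_compact; last exact: closed_ball_closed.
  exists (`|y0| + r%:num); split; first exact: num_real.
  move=> z rz y; rewrite KE => yr /=; rewrite (le_trans _ (ltW rz))//.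
  by rewrite -[y in leLHS](subKr y0) (le_trans (ler_normB _ _))// lerD2l.
have cC : closed C.
  apply: compact_closed; first exact: mhausdorff.
  apply: continuous_compact => //.
  apply: continuous_in_subspaceT => y; rewrite inE => Ky.
  by apply: cinv_cont; have [] := rW _ Ky.
pose d (l : 'I_n) x := cmap a x ord0 l + - y0 ord0 l.
pose h x := r%:num ^+ 2 + \sum_(l < n) -1 * (d l x * d l x).
pose chi x := if asbool (cdom a x) then flat 0 (h x) / flat 0 (r%:num ^+ 2) else 0.
have chi0 x : ~ C x -> chi x = 0.
  move=> nCx; rewrite /chi; case: asboolP => // ax.
  have [h0|h0] := leP (h x) 0; first by rewrite flat_le0 ?mul0r.
  case: nCx; exists (cmap a x); last exact: cmapK.
  (* The ball is for the sup norm: a coordinate of size more than r would make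
     h negative. *)
  rewrite KE [leLHS]mx_normrE; apply: bigmax_le => // -[i l] _ /=.
  rewrite !mxE ord1 distrC -(ler_pXn2r (n := 2)) ?nnegrE// real_normK ?num_real//.
  move: h0; rewrite /h -mulr_sumr mulN1r subr_gt0 => /ltW; apply: le_trans.
  rewrite (bigD1 l)//= -expr2 lerDl sumr_ge0// => k _.
  by rewrite -expr2 sqr_ge0.
have schi : smoothM_on setT chi.
  apply: smoothM_local => x _; have [Cx|nCx] := pselect (C x).
    exists (cdom a); split; first exact: Ca.
    have oa := cdom_open a.
    have sd l : smoothM_on (cdom a) (d l).
      exact: smoothMD oa (smoothM_chart_coord a l) (smoothM_cst _ _).
    have sh : smoothM_on (cdom a) h.
      apply: (smoothMD oa (smoothM_cst _ _)); apply: smoothM_sum => // l.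
      exact: smoothMM oa (smoothM_cst _ _) (smoothMM oa (sd l) (sd l)).
    have sfh := smoothM_comp1 oa (fun j => Ck_flat j 0) sh.
    apply: smoothM_ext (smoothMM oa sfh (smoothM_cst _ (flat 0 (r%:num ^+ 2))^-1)) => //.
    by move=> y ay /=; rewrite /chi; case: asboolP.
  exists (~` C); split => //.
  apply: smoothM_ext (smoothM_cst (~` C) 0); first exact: closed_openC.
  by move=> y nCy; rewrite chi0.
apply: inhabits; apply: (@Cutoff U m (SmoothFun schi) C) => //=.
rewrite /chi; case: asboolP => // _; rewrite (_ : h m = r%:num ^+ 2).
  by rewrite divff// gt_eqF// flat_gt0 ?exprn_gt0.
by rewrite /h big1 ?addr0// => l _; rewrite /d subrr !mulr0.
Qed.

End Bump.

(** * Subspaces of row vectors *)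

Section SubspaceProjection.
Context {F : fieldType} {n : nat} (S : set 'rV[F]_n).
Hypothesis S0 : S 0.
Hypothesis S_linear : forall c v w, S v -> S w -> S (c *: v + w).

Lemma subspace_submx p (Q : 'M[F]_(p, n)) (v : 'rV[F]_n) :
  (forall l, S (row l Q)) -> (v <= Q)%MS -> S v.
Proof.
move=> SQ /submxP[c ->]; rewrite mulmx_sum_row.
elim/big_ind: _ => [|x y Sx Sy|l _]; first exact: S0.
  by rewrite -[x]scale1r; exact: S_linear.
by rewrite -[_ *: _]addr0; exact: S_linear.
Qed.

(** A matrix of maximal rank among those with all rows in S has row space S;
    its pseudo-inverse turns it into a projection.  This is how a linear map
    defined on S alone gets extended to all row vectors. *)
Lemma subspace_projection : exists P : 'M[F]_n,
  (forall l, S (row l P)) /\ forall w, S w -> w *m P = w.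
Proof.
pose good k := `[< exists Q : 'M[F]_n, (forall l, S (row l Q)) /\ \rank Q = k >].
have good0 : exists k, good k.
  exists 0%N; apply/asboolP; exists 0; split; last exact: mxrank0.
  by move=> l; rewrite row0.
have goodn k : good k -> (k <= n)%N.
  by move=> /asboolP[Q [_ <-]]; exact: rank_leq_row.
have [_ /asboolP[Q [SQ <-]] Qmax] := ex_maxnP good0 goodn.
have SsubQ w : S w -> (w <= Q)%MS.
  move=> Sw; have /Qmax : good (\rank (Q + w)%MS).
    apply/asboolP; exists (Q + w)%MS; split=> // l.
    have /(subspace_submx (p := n + 1)) : (row l (Q + w)%MS <= col_mx Q w)%MS.
      by rewrite -addsmxE row_sub.
    apply=> k; rewrite -(splitK k); case: (fintype.split k) => k' /=.
      by rewrite rowKu.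
    by rewrite rowKd ord1 row_id.
  have /mxrank_leqif_sup[rle req] := addsmxSl Q w.
  move=> rge; have : (\rank Q == \rank (Q + w)%MS) by rewrite eqn_leq rle rge.
  by rewrite req; exact: submx_trans (addsmxSr _ _).
exists (pinvmx Q *m Q); split=> [l|w /SsubQ wQ]; last first.
  by rewrite mulmxA mulmxKpV.
by apply: (subspace_submx SQ); rewrite row_mul submxMl.
Qed.

End SubspaceProjection.

(** * Extending local sections *)

Section Extension.
Context {R : realType} {n : nat} {M : manifold R n}.
Implicit Types (U : set M).

Lemma smoothM_cutoff U V m (chi : cutoff U m) (f : M -> R) : open U -> open V ->
  smoothM_on (V `&` U) f -> smoothM_on V (fun x => chi x * f x).
Proof.
move=> oU oV sf; apply: smoothM_local => x Vx.
have [Cx|nCx] := pselect (cutoff_supp chi x).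
  exists (V `&` U); split; first by split=> //; exact: (cutoff_sub (c := chi)).
  apply: (smoothMM (openI oV oU) _ sf); apply: smoothM_sub (sfun_smooth chi) => //.
exists (~` cutoff_supp chi); split=> //.
apply: smoothM_ext (smoothM_cst _ 0); first exact/closed_openC/cutoff_closed.
by move=> y nCy; rewrite (cutoff0 nCy) mul0r.
Qed.

Variable E : vbundle M.

Lemma frame_linear i x : bdom i x -> linear (@frame R n M E i x).
Proof.
move=> ix c v w; rewrite -[LHS](coordK ix) -[RHS](coordK ix); congr frame.
by rewrite frameK// coord_linear// !frameK.
Qed.

Lemma smooth_local_frame m (i : triv_index E) (chi : cutoff (bdom i) m)
  (v : 'rV[R]_(brank i)) : smooth_section (fun x => chi x *: frame i x v).
Proof.
move=> j k; have oi := bdom_open i; have oj := bdom_open j.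
apply: smoothM_ext (smoothM_cutoff chi oi oj (triv_compat v k)) => // x jx.
by rewrite coordZ// mxE.
Qed.

Definition local_frame m (i : triv_index E) (chi : cutoff (bdom i) m) v :
  section E := MkSection (smooth_local_frame chi v).

Lemma smooth_local_coord m (i : triv_index E) (chi : cutoff (bdom i) m)
  (s : section E) k : smoothM_on setT (fun x => chi x * Defs.coord i (s x) ord0 k).
Proof.
apply: smoothM_cutoff (bdom_open i) openT _; rewrite setTI; exact: sec_smooth.
Qed.

Definition local_coord m (i : triv_index E) (chi : cutoff (bdom i) m) s k :
  smooth_fun M := SmoothFun (smooth_local_coord chi s k).

Lemma sec_sum (I : Type) (r : seq I) (s : I -> section E) x :
  (\sum_(k <- r) s k) x = \sum_(k <- r) s k x.
Proof. by elim: r => [|k r IH]; rewrite ?big_nil// !big_cons secD IH. Qed.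

(** Both the coordinates of s and the frame are only defined over the domain of
    the trivialization, hence one factor chi for each of them. *)
Lemma local_frame_decomposition m (i : triv_index E) (chi : cutoff (bdom i) m)
  (s : section E) :
  fscale chi (fscale chi s) =
  \sum_k fscale (local_coord chi s k) (local_frame chi (delta_mx ord0 k)).
Proof.
apply: section_eqP => x; rewrite sec_sum /=.
have [ix|nix] := pselect (bdom i x); last first.
  have -> : chi x = 0 by apply: cutoff0 => /cutoff_sub.
  by rewrite scale0r big1// => k _; rewrite mul0r scale0r.
have sE : s x = \sum_k Defs.coord i (s x) ord0 k *: frame i x (delta_mx ord0 k).
  rewrite -{1}[s x](coordK ix) {1}[Defs.coord i (s x)]row_sum_delta.
  have f0 : frame i x 0 = 0 :> E x.
    by have := frame_linear ix (-1) 0 0; rewrite !scaleN1r !addNr.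
  elim/big_ind2 : _ => // [e v e2 w <- <-|k _].
    by have := frame_linear ix 1 v w; rewrite !scale1r.
  have := frame_linear ix (Defs.coord i (s x) ord0 k) (delta_mx ord0 k) 0.
  by rewrite f0 !addr0.
rewrite {1}sE scalerA scaler_sumr; apply: eq_bigr => k _.
by rewrite !scalerA mulrAC.
Qed.

Lemma section_through m (e : E m) : exists s : section E, s m = e.
Proof.
have [i im] := bdom_cover E m; have [chi] := cutoff_exists (bdom_open i) im.
exists (local_frame chi (Defs.coord i e)).
by rewrite /= (cutoff1 chi) scale1r coordK.
Qed.

End Extension.

(** * Jets and the gauge algebroid *)

Section Jets.
Context {R : realType} {n : nat} {M : manifold R n}.

Lemma smooth_chart_differentiable (a : chart_index M) m (f : smooth_fun M) :
  cdom a m -> differentiable (f \o cinv a) (cmap a m).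
Proof.
by move=> am; have [+ _] := sfun_smooth f a 1%N; apply; split=> //; exact: cmap_img.
Qed.

Lemma smooth_centered_coord (a : chart_index M) m (chi : cutoff (cdom a) m) l :
  smoothM_on setT (fun x => chi x * (cmap a x ord0 l - cmap a m ord0 l)).
Proof.
have oa := cdom_open a; apply: (smoothM_cutoff (U := cdom a)) => //; first exact: openT.
rewrite setTI; exact: smoothMD oa (smoothM_chart_coord a l) (smoothM_cst _ _).
Qed.

Definition centered_coord (a : chart_index M) m (chi : cutoff (cdom a) m) l :
  smooth_fun M := SmoothFun (smooth_centered_coord chi l).

Lemma centered_coord0 a m (chi : cutoff (cdom a) m) l :
  centered_coord chi l m = 0.
Proof. by rewrite /= subrr mulr0. Qed.

(** The derivative of chi does not contribute, its factor vanishing at m; so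
    these functions have prescribed differentials at m. *)
Lemma derive_centered_coord a m (chi : cutoff (cdom a) m) l (w : 'rV[R]_n) :
  cdom a m -> 'D_w (centered_coord chi l \o cinv a) (cmap a m) = w ord0 l.
Proof.
move=> am; set y0 := cmap a m.
pose g (y : 'rV[R]_n) : R := y ord0 l - y0 ord0 l.
have dg y : is_derive y w g (w ord0 l).
  have dl : is_derive y w (fun y : 'rV[R]_n => y ord0 l : R) (w ord0 l).
    have d : derivable (fun y : 'rV[R]_n => y ord0 l : R) y w.
      by apply: diff_derivable; exact: differentiable_coord.
    apply: DeriveDef => //.
    have := derive_mx (@derivable_id _ _ y w).
    by rewrite derive_id => /matrixP/(_ ord0 l); rewrite mxE.
  have := is_deriveB dl (is_derive_cst (y0 ord0 l) y w).
  by rewrite subr0.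
have dc : derivable (chi \o cinv a) y0 w.
  by apply: diff_derivable; exact: smooth_chart_differentiable.
have gd : derivable g y0 w by case: (dg y0).
have dM := deriveM dc gd.
have gw := @derive_val _ _ _ _ _ _ _ (dg y0).
move: dM; rewrite gw /g subrr scale0r addr0 /= /y0 cmapK// (cutoff1 chi) scale1r => <-.
apply: near_eq_derive.
have : nbhs y0 (cimg a).
  by apply: open_nbhs_nbhs; split; [exact: cimg_open|exact: cmap_img].
by apply: filterS => y ay /=; rewrite cinvK.
Qed.

Variable E : vbundle M.

Lemma is_gauge_linear_comb c (D1 D2 : section E -> section E) :
  is_gauge D1 -> is_gauge D2 -> is_gauge (fun u => c *: D1 u + D2 u).
Proof.
move=> [l1 [j1 [[t1 s1] r1]]] [l2 [j2 [[t2 s2] r2]]]; split.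
  move=> b u v; rewrite l1 l2 scalerDr !scalerA [c * b]mulrC -!scalerA.
  by rewrite addrACA -scalerDr.
exists (fun m f => c * j1 m f + j2 m f); split; first split.
- move=> m; apply: is_tangentD (t2 m) => a am; have [w wE] := t1 m a am.
  exists (c *: w) => f; have df := smooth_chart_differentiable f am.
  by rewrite wE !deriveE// linearZ.
- by move=> f; exact: smoothMD openT (smoothMM openT (smoothM_cst _ c) (s1 f)) (s2 f).
- move=> f u m; rewrite !secD !secZ r1 r2 scalerDl scalerDr !scalerA.
  by rewrite [c * f m]mulrC -!scalerA addrACA scalerDr.
Qed.

Lemma DE_fiber_linear_comb m c (d1 d2 : section E -> E m) :
  DE_fiber d1 -> DE_fiber d2 -> DE_fiber (fun u => c *: d1 u + d2 u).
Proof.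
move=> [D1 g1 ->] [D2 g2 ->]; exists (fun u => c *: D1 u + D2 u) => //.
exact: is_gauge_linear_comb.
Qed.

(** The symbol is a tangent vector at m, given by its components in the chart a. *)
Definition has_symbol (a : chart_index M) m (d : section E -> E m)
    (w : 'rV[R]_n) :=
  forall (f : smooth_fun M) u,
    d (fscale f u) = f m *: d u + 'D_w (f \o cinv a) (cmap a m) *: u m.

Lemma DE_fiber_linear m (d : section E -> E m) : DE_fiber d -> linear d.
Proof. by move=> [D [lD _] ->] c u v /=; rewrite lD. Qed.

Lemma DE_fiber_symbol a m (d : section E -> E m) : cdom a m ->
  DE_fiber d -> exists w, has_symbol a d w.
Proof.
move=> am [D [_ [j [[tj _] rj]]] ->]; have [w wE] := tj m a am.
by exists w => f u /=; rewrite rj wE.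
Qed.

Lemma has_symbol_linear_comb a m c (d1 d2 : section E -> E m) w1 w2 : cdom a m ->
  has_symbol a d1 w1 -> has_symbol a d2 w2 ->
  has_symbol a (fun u => c *: d1 u + d2 u) (c *: w1 + w2).
Proof.
move=> am h1 h2 f u; have df := smooth_chart_differentiable f am.
rewrite h1 h2 !deriveE//.
have -> : 'd (f \o cinv a) (cmap a m) (c *: w1 + w2) =
    c * 'd (f \o cinv a) (cmap a m) w1 + 'd (f \o cinv a) (cmap a m) w2.
  by rewrite linearP.
rewrite scalerDl !scalerDr !scalerA.
by rewrite [c * f m]mulrC addrACA.
Qed.

(** With zero symbol, d is linear over functions, hence only depends on the
    value at m: expand the section in a local frame. *)
Lemma has_symbol0 a m (d : section E -> E m) : DE_fiber d -> has_symbol a d 0 ->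
  exists Psi : {linear E m -> E m}, d = (fun u => Psi (u m)).
Proof.
move=> Dd h; have [i im] := bdom_cover E m.
have [chi] := cutoff_exists (bdom_open i) im.
pose Psi (e : E m) : E m :=
  \sum_k Defs.coord i e ord0 k *: d (local_frame chi (delta_mx ord0 k)).
have lPsi : linear Psi.
  move=> c e e'; rewrite /Psi scaler_sumr -big_split; apply: eq_bigr => k _.
  by rewrite coord_linear// !mxE scalerDl scalerA.
pose PsiM := GRing.isLinear.Build _ _ _ _ Psi lPsi.
pose PsiL : {linear E m -> E m} := HB.pack Psi PsiM.
have h0 f u : d (fscale f u) = f m *: d u.
  by rewrite h derive0 scale0r addr0.
exists PsiL; apply/funext => u.
have := congr1 d (local_frame_decomposition chi u).
rewrite !h0 (cutoff1 chi) !scale1r => ->.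
have ld := DE_fiber_linear Dd.
have d0 : d 0 = 0 by have := ld (-1) 0 0; rewrite !scaleN1r !addNr.
have dD v w : d (v + w) = d v + d w by have := ld 1 v w; rewrite !scale1r.
rewrite (big_morph d dD d0); apply: eq_bigr => k _.
by rewrite h0 /= (cutoff1 chi) mul1r.
Qed.

(** Let s be a section with s(m) = nu(Id).  By the defining condition of the jet
    bundle, nu and the jet of s agree on the elements with zero symbol, so their
    difference is a linear function of the symbol.  The symbols form a subspace S
    of R^n; the projection P onto S extends that function to R^n, and the sections
    f_l t_l with f_l vanishing at m and d f_l = dx_l at m realize the extension. *)
Lemma JE_fiber_jet m (nu : (section E -> E m) -> E m) : JE_fiber nu ->
  exists u : section E, forall d, DE_fiber d -> nu d = d u.
Proof.
move=> [nuL nuPsi]; have [a am] := cdom_cover m.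
have [s sE] := section_through (nu (fun u => u m)).
have tensorial d : DE_fiber d -> has_symbol a d 0 -> nu d = d s.
  by move=> Dd /(has_symbol0 Dd)[Psi ->]; rewrite nuPsi sE.
pose S := [set w | exists d : section E -> E m, DE_fiber d /\ has_symbol a d w].
have DE0 : DE_fiber (fun _ : section E => 0 : E m).
  exists (fun _ => 0) => //; split; first by move=> c u v; rewrite scaler0 addr0.
  exists (fun _ _ => 0); split; first split.
  - move=> x b bx; exists 0 => f; by rewrite derive0.
  - by move=> f; exact: smoothM_cst.
  - by move=> f u x; rewrite scaler0 scale0r addr0.
have sym0 : has_symbol a (fun _ : section E => 0 : E m) 0.
  by move=> f u; rewrite derive0 scaler0 scale0r addr0.
have S0 : S 0 by exists (fun=> 0).
have SL c v w : S v -> S w -> S (c *: v + w).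
  move=> [d1 [D1 h1]] [d2 [D2 h2]]; exists (fun u => c *: d1 u + d2 u).
  by split; [exact: DE_fiber_linear_comb|exact: has_symbol_linear_comb].
have [P [SP PS]] := subspace_projection S0 SL.
have [e eP] := choice SP.
have [t tE] := choice (fun l => section_through (nu (e l) - e l s)).
have [chi] := cutoff_exists (cdom_open a) am.
exists (s + \sum_l fscale (centered_coord chi l) (t l)) => d Dd.
(* Subtracting from d the elements e_l chosen over the rows of P leaves an
   element of symbol w - w P = 0. *)
have [w wd] := DE_fiber_symbol am Dd.
have ld := DE_fiber_linear Dd.
have d0 : d 0 = 0 by have := ld (-1) 0 0; rewrite !scaleN1r !addNr.
have dD v v' : d (v + v') = d v + d v' by have := ld 1 v v'; rewrite !scale1r.
rewrite dD (big_morph d dD d0).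
under eq_bigr do
  rewrite wd centered_coord0 scale0r add0r derive_centered_coord// tE scalerBr.
pose dw (r : seq 'I_n) u := d u - \sum_(l <- r) w ord0 l *: e l u.
have dwP r : [/\ DE_fiber (dw r),
    has_symbol a (dw r) (w - \sum_(l <- r) w ord0 l *: row l P) &
    nu (dw r) = nu d - \sum_(l <- r) w ord0 l *: nu (e l)].
  elim: r => [|l r [IH1 IH2 IH3]].
    have -> : dw [::] = d by apply/funext => u; rewrite /dw big_nil subr0.
    by rewrite !big_nil !subr0.
  have [el1 el2] := eP l.
  have -> : dw (l :: r) = fun u => (- w ord0 l) *: e l u + dw r u.
    by apply/funext => u; rewrite /dw big_cons opprD addrCA addrA scaleNr -addrA.
  split; first exact: DE_fiber_linear_comb.
    by rewrite big_cons opprD addrCA -scaleNr; exact: has_symbol_linear_comb.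
  by rewrite nuL// IH3 big_cons opprD addrCA scaleNr.
have [D1 h1 n1] := dwP (index_enum 'I_n).
move: h1; rewrite -mulmx_sum_row PS ?subrr; last by exists d.
move=> /(tensorial _ D1); rewrite n1 /dw => /eqP; rewrite subr_eq => /eqP ->.
by rewrite -addrA sumrB; congr (_ + _); exact: addrC.
Qed.

End Jets.

(** * Abelian group identities *)

Section ZmodIdentities.

(** Identities between sums of sections hold in every abelian group; they are
    decided by comparing the integer coefficients of each atom. *)
Inductive zexpr := ZZero | ZVar of nat | ZAdd of zexpr & zexpr | ZOpp of zexpr.

Fixpoint zeval (V : zmodType) (env : seq V) (e : zexpr) : V :=
  match e with
  | ZZero => 0
  | ZVar i => nth 0 env i
  | ZAdd e1 e2 => zeval env e1 + zeval env e2
  | ZOpp e1 => - zeval env e1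
  end.

Fixpoint zcoef (e : zexpr) (i : nat) : int :=
  match e with
  | ZZero => 0
  | ZVar j => (i == j)%:Z
  | ZAdd e1 e2 => zcoef e1 i + zcoef e2 i
  | ZOpp e1 => - zcoef e1 i
  end.

Lemma zevalE (V : zmodType) (env : seq V) e :
  zeval env e = \sum_(i < size env) nth 0 env i *~ zcoef e i.
Proof.
elim: e => [|j|e1 IH1 e2 IH2|e1 IH1] /=.
- by rewrite big1.
- have [jn|jn] := ltnP j (size env); last first.
    rewrite nth_default// big1// => i _.
    by rewrite (ltn_eqF (leq_trans (ltn_ord i) jn)).
  rewrite (bigD1 (Ordinal jn))//= eqxx big1 ?addr0// => i.
  by rewrite -val_eqE /= => /negPf ->.
- by rewrite IH1 IH2 -big_split; apply: eq_bigr => i _; rewrite mulrzDr.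
- by rewrite IH1 -sumrN; apply: eq_bigr => i _; rewrite mulrNz.
Qed.

Lemma zeval_eq (V : zmodType) (env : seq V) e1 e2 :
  all (fun i => zcoef e1 i == zcoef e2 i) (iota 0 (size env)) ->
  zeval env e1 = zeval env e2.
Proof.
move=> /allP h; rewrite !zevalE; apply: eq_bigr => i _.
by rewrite (eqP (h i _))// mem_iota ltn_ord.
Qed.

(** Reduces an equation to an earlier one c = d modulo a formal identity. *)
Lemma zmod_eq_by (V : zmodType) (a b c d : V) : c = d -> a - b = c - d -> a = b.
Proof. by move=> ->; rewrite subrr => /eqP; rewrite subr_eq0 => /eqP. Qed.

End ZmodIdentities.

(** Scalings are compared by their arguments, as equal ones may carry different
    but convertible module structures. *)
Ltac zindex x env :=
  lazymatch env with
  | x :: _ => constr:(0%N)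
  | ?y :: ?env' =>
      match constr:((x, y)) with
      | (@GRing.scale _ _ ?c ?v, @GRing.scale _ _ ?c ?v) => constr:(0%N)
      | _ => let i := zindex x env' in constr:(S i)
      end
  end.

Ltac zinsert x env :=
  match env with
  | _ => let i := zindex x env in env
  | _ => constr:(x :: env)
  end.

Ltac zatoms t env :=
  lazymatch t with
  | 0%R => env
  | (?a + ?b)%R => let env1 := zatoms a env in zatoms b env1
  | (- ?a)%R => zatoms a env
  | _ => zinsert t env
  end.

Ltac zreify t env :=
  lazymatch t with
  | 0%R => constr:(ZZero)
  | (?a + ?b)%R =>
      let a' := zreify a env in let b' := zreify b env in constr:(ZAdd a' b')
  | (- ?a)%R => let a' := zreify a env in constr:(ZOpp a')
  | _ => let i := zindex t env in constr:(ZVar i)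
  end.

Ltac zmodule :=
  lazymatch goal with
  | |- @eq ?T ?a ?b =>
      let env0 := zatoms a (@nil T) in
      let env := zatoms b env0 in
      let a' := zreify a env in let b' := zreify b env in
      apply: (@zeval_eq _ env a' b'); vm_compute; reflexivity
  end.

(** * The Leibniz identity for Dorfman brackets *)

Section DorfmanBracket.
Variables (V W : zmodType) (q : V -> V -> W) (br : V -> V -> V).
Variables (r : V -> W -> W) (D : W -> V).
Hypothesis qDl : forall x y z, q (x + y) z = q x z + q y z.
Hypothesis qC : forall x y, q x y = q y x.
Hypothesis q_nondegenerate : forall x, (forall y, q x y = 0) -> x = 0.
Hypothesis brDl : forall x y z, br (x + y) z = br x z + br y z.
Hypothesis brDr : forall x y z, br x (y + z) = br x y + br x z.
Hypothesis rD : forall x u v, r x (u + v) = r x u + r x v.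
Hypothesis qD : forall u x, q (D u) x = r x u.
Hypothesis r_br : forall x y u, r (br x y) u = r x (r y u) - r y (r x u).
Hypothesis r_q : forall x y z, r x (q y z) = q (br x y) z + q y (br x z).
Hypothesis br_sym : forall x y, br x y + br y x = D (q x y).
Hypothesis brD : forall u x, br (D u) x = 0.

(** The failure of the Leibniz identity; pairing it with a fourth element gives
    the form which turns out to be totally antisymmetric. *)
Definition jacobiator x y z := br x (br y z) - br (br x y) z - br y (br x z).

Local Notation T x y z w := (q (jacobiator x y z) w).

Let additive_zero (U : zmodType) (f : V -> U) :
  (forall x y, f (x + y) = f x + f y) -> f 0 = 0.
Proof. by move=> fD; apply: (addrI (f 0)); rewrite -fD !addr0. Qed.

Let additive_opp (U : zmodType) (f : V -> U) :
  (forall x y, f (x + y) = f x + f y) -> forall x, f (- x) = - f x.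
Proof.
move=> fD x; apply: (addrI (f x)); rewrite -fD !subrr; exact: additive_zero.
Qed.

Let qDr x y z : q x (y + z) = q x y + q x z.
Proof. by rewrite !(qC x) qDl. Qed.
Let q0l y : q 0 y = 0.
Proof. exact: (additive_zero (f := q^~ y)) (fun a b => qDl a b y). Qed.
Let qNl x y : q (- x) y = - q x y.
Proof. exact: (additive_opp (f := q^~ y)) (fun a b => qDl a b y) x. Qed.
Let qNr x y : q x (- y) = - q x y.
Proof. by rewrite !(qC x) qNl. Qed.

Lemma bracket_d x u : br x (D u) = D (r x u).
Proof. by rewrite -qD qC -br_sym brD addr0. Qed.

(** The symmetric part of the bracket is D q, and D u brackets to zero. *)
Lemma jacobiator_anti12 x y z w : T x y z w = - T y x z w.
Proof.
rewrite /jacobiator !qDl !qNl.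
have h : q (br (br x y) z) w + q (br (br y x) z) w = 0.
  by rewrite -qDl -brDl br_sym brD q0l.
by apply: (zmod_eq_by (esym h)); zmodule.
Qed.

(** Move both brackets across q with the derivation property; what remains is
    the commutator of r x and r y minus r of their bracket, which vanishes. *)
Lemma jacobiator_anti34 x y z w : T x y z w = - T x y w z.
Proof.
have h a b : q (br a (br b z)) w = r a (r b (q z w)) - r a (q z (br b w)) -
    r b (q z (br a w)) + q z (br b (br a w)).
  have e1 := r_q a (br b z) w; have e2 := r_q b z w; have e3 := r_q b z (br a w).
  rewrite e2 rD e1 e3; zmodule.
have h' := r_q (br x y) z w.
rewrite [q _ z]qC /jacobiator !qDl !qNl !qDr !qNr (h x y) (h y x).
rewrite r_br in h'; apply: (zmod_eq_by h'); zmodule.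
Qed.

Let DD u v : D (u + v) = D u + D v.
Proof.
apply/eqP; rewrite -subr_eq0; apply/eqP; apply: q_nondegenerate => y.
by rewrite qDl qNl qDl !qD rD subrr.
Qed.

(** The symmetrization in y, z is br x (D u) - D (r x u) with u = q y z. *)
Lemma jacobiator_anti23 x y z w : T x y z w = - T x z y w.
Proof.
have h : br x (br y z) + br x (br z y) = br (br x y) z + br z (br x y) +
    (br y (br x z) + br (br x z) y).
  by rewrite -brDr !br_sym bracket_d r_q DD.
rewrite -qNl; congr q; apply: (zmod_eq_by h); rewrite /jacobiator; zmodule.
Qed.

Variables (PA PB : V -> Prop).
Hypothesis split_AB : forall z, exists a b, [/\ PA a, PB b & z = a + b].
Hypothesis jacobi_AAA :
  forall a b c, PA a -> PA b -> PA c -> jacobiator a b c = 0.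
Hypothesis jacobi_BBB :
  forall a b c, PB a -> PB b -> PB c -> jacobiator a b c = 0.
Hypothesis jacobi_AABB : forall a b c d, PA a -> PA b -> PB c -> PB d ->
  q (jacobiator a b c) d = 0.

(** An antisymmetric form in four arguments on A + B vanishes as soon as it does
    when three arguments lie in the same summand, or two in each. *)
Theorem jacobiator_zero x y z : jacobiator x y z = 0.
Proof.
apply: q_nondegenerate => w.
have swap12 a b c d : T a b c d = 0 -> T b a c d = 0.
  by rewrite (jacobiator_anti12 a) => /eqP; rewrite oppr_eq0 => /eqP.
have swap23 a b c d : T a b c d = 0 -> T a c b d = 0.
  by rewrite (jacobiator_anti23 a) => /eqP; rewrite oppr_eq0 => /eqP.
have swap34 a b c d : T a b c d = 0 -> T a b d c = 0.
  by rewrite (jacobiator_anti34 a) => /eqP; rewrite oppr_eq0 => /eqP.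
have AAAx a b c d : PA a -> PA b -> PA c -> T a b c d = 0.
  by move=> ? ? ?; rewrite jacobi_AAA.
have BBBx a b c d : PB a -> PB b -> PB c -> T a b c d = 0.
  by move=> ? ? ?; rewrite jacobi_BBB.
have T4 a b c d d' : T a b c d = 0 -> T a b c d' = 0 -> T a b c (d + d') = 0.
  by rewrite qDr => -> ->; rewrite addr0.
have T3 a b c c' d : T a b c d = 0 -> T a b c' d = 0 -> T a b (c + c') d = 0.
  by move=> h h'; apply/swap34; apply/T4; apply/swap34.
have T2 a b b' c d : T a b c d = 0 -> T a b' c d = 0 -> T a (b + b') c d = 0.
  by move=> h h'; apply/swap23; apply/T3; apply/swap23.
have T1 a a' b c d : T a b c d = 0 -> T a' b c d = 0 -> T (a + a') b c d = 0.
  by move=> h h'; apply/swap12; apply/T2; apply/swap12.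
have [x1 [x2 [Ax Bx ->]]] := split_AB x; have [y1 [y2 [Ay By ->]]] := split_AB y.
have [z1 [z2 [Az Bz ->]]] := split_AB z; have [w1 [w2 [Aw Bw ->]]] := split_AB w.
(* Adjacent swaps bring each of the sixteen cases to a hypothesis. *)
by apply/T1; apply/T2; apply/T3; apply/T4; auto 8.
Qed.

End DorfmanBracket.

(** * Calculus on a Lie algebroid with values in E *)

Section Pairing.
Context {R : realType} {n : nat} {M : manifold R n} {E A B : vbundle M}.
Variable p : bilmap A B E.

Lemma bsecPl b c X Y : bsec p (c *: X + Y) b = c *: bsec p X b + bsec p Y b.
Proof. by apply: section_eqP => m; exact: bmap_linearl. Qed.

Lemma bsecPr X c a b : bsec p X (c *: a + b) = c *: bsec p X a + bsec p X b.
Proof. by apply: section_eqP => m; exact: bmap_linearr. Qed.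

Lemma bmap0l m (b : B m) : p m 0 b = 0.
Proof. by have := bmap_linearl p b (-1) 0 0; rewrite !scaleN1r !addNr. Qed.

Lemma bmap0r m (a : A m) : p m a 0 = 0.
Proof. by have := bmap_linearr p a (-1) 0 0; rewrite !scaleN1r !addNr. Qed.

Lemma bsecDl X Y b : bsec p (X + Y) b = bsec p X b + bsec p Y b.
Proof. by have := bsecPl b 1 X Y; rewrite !scale1r. Qed.

Lemma bsecDr X a b : bsec p X (a + b) = bsec p X a + bsec p X b.
Proof. by have := bsecPr X 1 a b; rewrite !scale1r. Qed.

Lemma bsec0l b : bsec p 0 b = 0.
Proof. by apply: section_eqP => m; exact: bmap0l. Qed.

Lemma bsec0r X : bsec p X 0 = 0.
Proof. by apply: section_eqP => m; exact: bmap0r. Qed.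

Lemma bsecNl X b : bsec p (- X) b = - bsec p X b.
Proof. by apply: (addrI (bsec p X b)); rewrite -bsecDl !subrr bsec0l. Qed.

Lemma bsecNr X b : bsec p X (- b) = - bsec p X b.
Proof. by apply: (addrI (bsec p X b)); rewrite -bsecDr !subrr bsec0r. Qed.

Definition bsecE := (bsecDl, bsecDr, bsecNl, bsecNr).

(** Nondegeneracy is fibrewise, so the test against sections needs a section
    through each vector. *)
Lemma bsec_injr : E_dual p ->
  forall b b', (forall Y, bsec p Y b = bsec p Y b') -> b = b'.
Proof.
move=> [_ nd] b b' h; apply: section_eqP => m; apply/eqP; rewrite -subr_eq0.
apply/eqP; apply: nd => a; have [Y <-] := section_through a.
have /(congr1 (fun s : section E => s m)) /= : bsec p Y (b - b') = 0.
  by rewrite bsecDr bsecNr h subrr.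
by rewrite -secN; exact.
Qed.

End Pairing.

Section Action.
Context {R : realType} {n : nat} {M : manifold R n} {E A : vbundle M}.
Variable rho : demap A E.

Lemma actPl c X Y u : act rho (c *: X + Y) u = c *: act rho X u + act rho Y u.
Proof. by apply: section_eqP => m; exact: dmap_linear. Qed.

Lemma actPr X c u v : act rho X (c *: u + v) = c *: act rho X u + act rho X v.
Proof. by have [l _] := dmap_gauge rho X; exact: l. Qed.

Lemma actDl X Y u : act rho (X + Y) u = act rho X u + act rho Y u.
Proof. by have := actPl 1 X Y u; rewrite !scale1r. Qed.

Lemma actDr X u v : act rho X (u + v) = act rho X u + act rho X v.
Proof. by have := actPr X 1 u v; rewrite !scale1r. Qed.

Lemma act0l u : act rho 0 u = 0.
Proof. by apply: (addrI (act rho 0 u)); rewrite -actDl !addr0. Qed.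

Lemma act0r X : act rho X 0 = 0.
Proof. by apply: (addrI (act rho X 0)); rewrite -actDr !addr0. Qed.

Lemma actNl X u : act rho (- X) u = - act rho X u.
Proof. by apply: (addrI (act rho X u)); rewrite -actDl !subrr act0l. Qed.

Lemma actNr X u : act rho X (- u) = - act rho X u.
Proof. by apply: (addrI (act rho X u)); rewrite -actDr !subrr act0r. Qed.

Lemma actZr X c u : act rho X (c *: u) = c *: act rho X u.
Proof. by have := actPr X c u 0; rewrite act0r !addr0. Qed.

Definition actE := (actDl, actDr, actNl, actNr).

End Action.

Section LieAlgebroidBracket.
Context {R : realType} {n : nat} {M : manifold R n} {A : vbundle M}.
Variable LA : lie_algebroid A.

Lemma la_brPl c X Y Z : LA (c *: X + Y) Z = c *: LA X Z + LA Y Z.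
Proof. exact: la_linearl. Qed.

Lemma la_brPr c X Y Z : LA X (c *: Y + Z) = c *: LA X Y + LA X Z.
Proof. exact: la_linearr. Qed.

Lemma la_brDl X Y Z : LA (X + Y) Z = LA X Z + LA Y Z.
Proof. by have := la_brPl 1 X Y Z; rewrite !scale1r. Qed.

Lemma la_brDr X Y Z : LA X (Y + Z) = LA X Y + LA X Z.
Proof. by have := la_brPr 1 X Y Z; rewrite !scale1r. Qed.

Lemma la_brC X Y : LA X Y = - LA Y X.
Proof.
apply/eqP; rewrite -addr_eq0; apply/eqP; have := la_alt LA (X + Y).
by rewrite la_brDl !la_brDr !la_alt add0r addr0.
Qed.

Lemma la_br0r X : LA X 0 = 0.
Proof. by apply: (addrI (LA X 0)); rewrite -la_brDr !addr0. Qed.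

Lemma la_br0l X : LA 0 X = 0.
Proof. by rewrite la_brC la_br0r oppr0. Qed.

End LieAlgebroidBracket.

Section Cartan.
Context {R : realType} {n : nat} {M : manifold R n} {E A B : vbundle M}.
Variables (LA : lie_algebroid A) (p : bilmap A B E) (rho : demap A E).
Hypothesis dual_p : E_dual p.
Hypothesis rep_rho : is_representation LA rho.
Hypothesis inv_rho : is_invariant LA rho p.

Lemma dCE_form1 b (X : 'I_2 -> section A) :
  dCE LA rho (form1 p b) X =
  act rho (X ord0) (bsec p (X ord_max) b) -
  act rho (X ord_max) (bsec p (X ord0) b) -
  bsec p (LA (X ord0) (X ord_max)) b.
Proof.
rewrite /dCE /form1 !big_ord_recl !big_ord0 /=.
have e1 : lift ord0 ord0 = ord_max :> 'I_2 by exact: val_inj.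
have e2 : lift ord_max ord0 = ord0 :> 'I_2 by exact: val_inj.
rewrite [\sum_(j < 2 | (_ < j)%N) _]big_mkcond !big_ord_recl !big_ord0 /= e1 e2.
rewrite [\sum_(j < 2 | _) _]big1; last by case=> [[|[|j]] j2].
by rewrite addr0 add0r !addr0 !scaleN1r scale1r.
Qed.

(** Invariance of the representation in degree 0 is what makes the defining
    equation of dsec solvable. *)
Lemma bsec_dsec X u : bsec p X (dsec LA rho p u) = act rho X u.
Proof.
have dE (Y : 'I_1 -> section A) : dCE LA rho (form0 u) Y = act rho (Y ord0) u.
  rewrite /dCE !big_ord_recl !big_ord0 /= big_mkcond big_ord_recl big_ord0 /=.
  by rewrite !addr0 scale1r.
have form0P : is_form_in p (form0 (A := A) u).
  by split; [split; [move=> Y []|move=> Y []]|case].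
have [_ /(_ ord0 erefl)/(_ (fun=> X))[beta bE]] := inv_rho form0P.
rewrite /dsec; case: xgetP => [_ -> /= /(congr1 (fun w => w (fun=> X)))|/(_ beta)[]].
  by rewrite dE.
apply/funext => Y; rewrite dE /form1 /=.
by have := bE (Y ord0); rewrite dE /upd eqxx.
Qed.

(** Cartan's formula: L_X xi = i_X d xi + d (i_X xi), where i_X d xi is a section
    of B by invariance in degree 1. *)
Lemma bsec_lie X Y xi :
  bsec p Y (lie LA rho p X xi) = act rho X (bsec p Y xi) - bsec p (LA X Y) xi.
Proof.
have form1P : is_form_in p (form1 p xi).
  split; first split.
  - move=> Z i f Y1 Y2; rewrite /form1 /upd !ord1 eqxx; apply: section_eqP => m.
    exact: bmap_linearl.
  - by move=> Z i j; rewrite !ord1 eqxx.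
  - by move=> i _ Z; exists xi => W; rewrite /form1 /upd !ord1 eqxx.
have [_ /(_ ord_max erefl)/(_ (fun=> X))[beta bE]] := inv_rho form1P.
rewrite /lie; case: xgetP => [_ -> //|/(_ (beta + dsec LA rho p (bsec p X xi)))[]].
move=> Z /=; rewrite bsecDr -bE dCE_form1 /upd /= bsec_dsec; zmodule.
Qed.

Lemma dsecP c u v : dsec LA rho p (c *: u + v) = c *: dsec LA rho p u + dsec LA rho p v.
Proof. by apply: (bsec_injr dual_p) => Y; rewrite bsecPr !bsec_dsec actPr. Qed.

Lemma dsecD u v : dsec LA rho p (u + v) = dsec LA rho p u + dsec LA rho p v.
Proof. by have := dsecP 1 u v; rewrite !scale1r. Qed.

Lemma liePl c X Y xi :
  lie LA rho p (c *: X + Y) xi = c *: lie LA rho p X xi + lie LA rho p Y xi.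
Proof.
apply: (bsec_injr dual_p) => Z; rewrite bsecPr !bsec_lie actPl la_brPl bsecPl.
by rewrite scalerBr; zmodule.
Qed.

Lemma liePr X c xi eta :
  lie LA rho p X (c *: xi + eta) = c *: lie LA rho p X xi + lie LA rho p X eta.
Proof.
apply: (bsec_injr dual_p) => Z; rewrite bsecPr !bsec_lie !bsecPr actPr.
by rewrite scalerBr; zmodule.
Qed.

Lemma dsec0 : dsec LA rho p 0 = 0.
Proof. by apply: (bsec_injr dual_p) => Y; rewrite bsec_dsec act0r bsec0r. Qed.

Lemma lie0l xi : lie LA rho p 0 xi = 0.
Proof.
apply: (bsec_injr dual_p) => Y.
by rewrite bsec_lie act0l la_br0l bsec0l bsec0r subrr.
Qed.

Lemma lie0r X : lie LA rho p X 0 = 0.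
Proof.
by apply: (bsec_injr dual_p) => Y; rewrite bsec_lie !bsec0r act0r subrr.
Qed.

(** The Lie derivative commutes with d on sections of E, because rho preserves
    brackets. *)
Lemma lie_dsec X u : lie LA rho p X (dsec LA rho p u) = dsec LA rho p (act rho X u).
Proof.
have [_ br_rho] := rep_rho.
apply: (bsec_injr dual_p) => Y; rewrite bsec_lie !bsec_dsec br_rho; zmodule.
Qed.

Lemma bmap_dsec m (a : A m) u : p m a (dsec LA rho p u m) = rho m a u.
Proof.
have [X <-] := section_through a.
exact: (congr1 (fun s : section E => s m) (bsec_dsec X u)).
Qed.

End Cartan.

(** * The double of an E-Lie bialgebroid *)

Section Double.
Context {R : realType} {n : nat} {M : manifold R n} {E A B : vbundle M}.
Variables (LA : lie_algebroid A) (LB : lie_algebroid B) (p : bilmap A B E).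
Variables (rhoA : demap A E) (rhoB : demap B E).
Hypothesis bialg : is_E_Lie_bialgebroid LA LB p rhoA rhoB.

Local Notation "<< X , xi >>" := (bsec p X xi) (at level 0, X, xi at level 69).
Local Notation rA := (act rhoA).
Local Notation rB := (act rhoB).
Local Notation dA := (dsec LA rhoA p).
Local Notation dB := (dsec LB rhoB (bswap p)).
Local Notation lieA := (lie LA rhoA p).
Local Notation lieB := (lie LB rhoB (bswap p)).
Local Notation br := (double_bracket LA LB p rhoA rhoB).
Implicit Types (X Y : section A) (xi eta : section B) (u v : section E).
Implicit Types (Z W : section (dsum A B)).

Let pair_bialg := elb_pair bialg.
Let dual_p := edp_dual pair_bialg.
Let dual_sp : E_dual (bswap p). Proof. by have [? ?] := dual_p; split. Qed.
Let repA := edp_repA pair_bialg.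
Let repB := edp_repB pair_bialg.
Let invA := edp_invA pair_bialg.
Let invB := edp_invB pair_bialg.

Let injr xi eta : (forall Y, <<Y, xi>> = <<Y, eta>>) -> xi = eta.
Proof. exact: bsec_injr. Qed.
Let injl X Y : (forall xi, <<X, xi>> = <<Y, xi>>) -> X = Y.
Proof. exact: (bsec_injr dual_sp). Qed.

Let pair_dA X u : <<X, dA u>> = rA X u. Proof. exact: bsec_dsec. Qed.
Let pair_dB xi u : <<dB u, xi>> = rB xi u.
Proof. exact: (bsec_dsec invB xi u). Qed.
Let pair_lieA X Y xi : <<Y, lieA X xi>> = rA X <<Y, xi>> - <<LA X Y, xi>>.
Proof. exact: bsec_lie. Qed.
Let pair_lieB xi eta X : <<lieB xi X, eta>> = rB xi <<X, eta>> - <<X, LB xi eta>>.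
Proof. exact: (bsec_lie invB xi eta X). Qed.

Let rA_br X Y u : rA (LA X Y) u = rA X (rA Y u) - rA Y (rA X u).
Proof. by have [_ ->] := repA. Qed.
Let rB_br xi eta u : rB (LB xi eta) u = rB xi (rB eta u) - rB eta (rB xi u).
Proof. by have [_ ->] := repB. Qed.

(** Polarization of the isotropy condition. *)
Lemma dsec_isotropic u v : <<dB u, dA v>> = - <<dB v, dA u>>.
Proof.
have iso := elb_isotropic bialg.
have := iso (u + v); rewrite !dsecD// bsecDl !bsecDr !iso add0r addr0.
by move/eqP; rewrite addr_eq0 => /eqP.
Qed.

Lemma anchor_d u v : rA (dB u) v + rB (dA u) v = 0.
Proof. by rewrite -pair_dA -pair_dB dsec_isotropic addNr. Qed.

(** The compatibility of d^A u and d^B u with the bracket of A is transported to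
    the bracket of B by pairing; the two anchor terms cancel by isotropy. *)
Lemma lie_d_dual u xi : lieA (dB u) xi = - LB (dA u) xi.
Proof.
apply: injr => X; rewrite pair_lieA bsecNr.
have /(congr1 (fun Y => <<Y, xi>>)) := elb_lie bialg u X.
rewrite pair_lieB bsecNl => h.
have h2 := anchor_d u <<X, xi>>.
have h3 : rA (dB u) <<X, xi>> - <<LA (dB u) X, xi>> + <<X, LB (dA u) xi>> = 0.
  by rewrite -{}h -[RHS]h2; zmodule.
by apply: (zmod_eq_by h3); zmodule.
Qed.

(** Twice the pairing of the E-Courant algebroid: without the factor 1/2 the
    section D u represents the functional Z |-> r(Z) u. *)
Definition double_pairing Z W := <<sec_fst Z, sec_snd W>> + <<sec_fst W, sec_snd Z>>.
Definition double_anchor Z u := rA (sec_fst Z) u + rB (sec_snd Z) u.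
Definition double_d u := sec_pair (dB u) (dA u).

Local Notation q := double_pairing.
Local Notation r := double_anchor.
Local Notation D := double_d.
Local Notation fst := sec_fst.
Local Notation snd := sec_snd.

Lemma sec_pairK1 X xi : fst (sec_pair X xi) = X.
Proof. exact: section_eqP. Qed.
Lemma sec_pairK2 X xi : snd (sec_pair X xi) = xi.
Proof. exact: section_eqP. Qed.
Definition sec_pairK := (sec_pairK1, sec_pairK2).

Lemma double_ext Z W : fst Z = fst W -> snd Z = snd W -> Z = W.
Proof.
move=> e1 e2; apply: section_eqP => x; rewrite [Z x]surjective_pairing.
rewrite [RHS]surjective_pairing; congr pair.
  exact: (congr1 (fun s : section A => s x) e1).
exact: (congr1 (fun s : section B => s x) e2).
Qed.

Lemma fstD Z W : fst (Z + W) = fst Z + fst W. Proof. exact: section_eqP. Qed.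
Lemma sndD Z W : snd (Z + W) = snd Z + snd W. Proof. exact: section_eqP. Qed.
Lemma fstZ c Z : fst (c *: Z) = c *: fst Z. Proof. exact: section_eqP. Qed.
Lemma sndZ c Z : snd (c *: Z) = c *: snd Z. Proof. exact: section_eqP. Qed.
Lemma fstN Z : fst (- Z) = - fst Z.
Proof. by rewrite -[- Z]scaleN1r fstZ scaleN1r. Qed.
Lemma sndN Z : snd (- Z) = - snd Z.
Proof. by rewrite -[- Z]scaleN1r sndZ scaleN1r. Qed.
Lemma fst0 : fst (0 : section (dsum A B)) = 0. Proof. exact: section_eqP. Qed.
Lemma snd0 : snd (0 : section (dsum A B)) = 0. Proof. exact: section_eqP. Qed.

Lemma fst_br Z W : fst (br Z W) =
  LA (fst Z) (fst W) + lieB (snd Z) (fst W) - lieB (snd W) (fst Z) +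
  dB <<fst Z, snd W>>.
Proof. exact: sec_pairK1. Qed.
Lemma snd_br Z W : snd (br Z W) =
  LB (snd Z) (snd W) + lieA (fst Z) (snd W) - lieA (fst W) (snd Z) +
  dA <<fst W, snd Z>>.
Proof. exact: sec_pairK2. Qed.

Lemma double_bracket_linearl W : linear (br^~ W).
Proof.
move=> c Z Z'; apply: double_ext.
  rewrite fstD fstZ !fst_br fstD fstZ sndD sndZ la_brPl bsecPl.
  rewrite (liePl dual_sp invB) (liePr dual_sp invB) (dsecP dual_sp invB).
  by rewrite !scalerDr scalerN; zmodule.
rewrite sndD sndZ !snd_br fstD fstZ sndD sndZ la_brPl bsecPr.
rewrite (liePl dual_p invA) (liePr dual_p invA) (dsecP dual_p invA).
by rewrite !scalerDr scalerN; zmodule.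
Qed.

Lemma double_bracket_linearr Z : linear (br Z).
Proof.
move=> c W W'; apply: double_ext.
  rewrite fstD fstZ !fst_br fstD fstZ sndD sndZ la_brPr bsecPr.
  rewrite (liePl dual_sp invB) (liePr dual_sp invB) (dsecP dual_sp invB).
  by rewrite !scalerDr scalerN; zmodule.
rewrite sndD sndZ !snd_br fstD fstZ sndD sndZ la_brPr bsecPl.
rewrite (liePl dual_p invA) (liePr dual_p invA) (dsecP dual_p invA).
by rewrite !scalerDr scalerN; zmodule.
Qed.

Lemma double_pairingDl Z Z' W : q (Z + Z') W = q Z W + q Z' W.
Proof. by rewrite /q fstD sndD bsecDl bsecDr; zmodule. Qed.

Lemma double_pairingC Z W : q Z W = q W Z.
Proof. by rewrite /q addrC. Qed.

Lemma double_pairing_nondegenerate Z : (forall W, q Z W = 0) -> Z = 0.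
Proof.
move=> h; apply: double_ext; rewrite ?fst0 ?snd0.
  apply: injl => xi; have := h (sec_pair 0 xi).
  by rewrite /q !sec_pairK !bsec0l addr0.
apply: injr => X; have := h (sec_pair X 0).
by rewrite /q !sec_pairK !bsec0r add0r.
Qed.

Lemma double_pairing_d u Z : q (D u) Z = r Z u.
Proof. by rewrite /q /r !sec_pairK pair_dA pair_dB addrC. Qed.

(** In each component the derivative of d u and the differential of a pairing
    cancel, leaving [elb_lie] or its dual. *)
Lemma double_d_bracket u Z : br (D u) Z = 0.
Proof.
apply: double_ext; rewrite ?fst_br ?snd_br ?fst0 ?snd0 !sec_pairK.
  rewrite (lie_dsec dual_sp repB invB) pair_dB (elb_lie bialg); zmodule.
rewrite (lie_dsec dual_p repA invA) pair_dA lie_d_dual; zmodule.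
Qed.

Lemma double_bracket_sym Z W : br Z W + br W Z = D (q Z W).
Proof.
apply: double_ext; rewrite ?fstD ?sndD ?fst_br ?snd_br !sec_pairK /q.
  by rewrite (dsecD dual_sp invB) [LA (fst W) _]la_brC; zmodule.
by rewrite (dsecD dual_p invA) [LB (snd W) _]la_brC; zmodule.
Qed.

Lemma double_anchor_pairing Z Z1 Z2 : r Z (q Z1 Z2) = q (br Z Z1) Z2 + q Z1 (br Z Z2).
Proof.
rewrite /r /q !actDr !fst_br !snd_br !bsecE !pair_lieA !pair_lieB !pair_dA !pair_dB.
rewrite [LA (fst Z2) (fst Z1)]la_brC.
rewrite [LB (snd Z2) (snd Z1)]la_brC !bsecE.
by zmodule.
Qed.

(** The bracket of an element of A with one of B: both mixed Lie derivatives are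
    expanded against d^A u and d^B u, and the error is [elb_lie] paired with xi,
    up to the anchor of D u. *)
Let anchor_mixed X xi u :
  rA (dB <<X, xi>> - lieB xi X) u + rB (lieA X xi) u =
  rA X (rB xi u) - rB xi (rA X u).
Proof.
have d1 : rA (dB <<X, xi>>) u = - rA (dB u) <<X, xi>>.
  by rewrite -!pair_dA dsec_isotropic.
have d2 := anchor_d u <<X, xi>>.
have d3 : rA (lieB xi X) u = rB xi (rA X u) - <<X, LB xi (dA u)>>.
  by rewrite -!pair_dA pair_lieB.
have d4 : rB (lieA X xi) u = rA X (rB xi u) - <<LA X (dB u), xi>>.
  by rewrite -!pair_dB pair_lieA.
have /(congr1 (fun Y => <<Y, xi>>)) := elb_lie bialg u X.
rewrite pair_lieB bsecNl => d5.
rewrite actDl actNl d1 d3 d4 [LB xi _]la_brC [LA X _]la_brC !bsecE.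
have d6 := congr2 (fun a b => a - b) d5 d2.
by apply: (zmod_eq_by d6); zmodule.
Qed.

Lemma double_anchor_bracket Z W u :
  r (br Z W) u = r Z (r W u) - r W (r Z u).
Proof.
rewrite /r fst_br snd_br !actE rA_br rB_br.
have m1 := anchor_mixed (fst Z) (snd W) u.
have m2 := anchor_mixed (fst W) (snd Z) u.
have m3 := anchor_d <<fst W, snd Z>> u.
rewrite !actE in m1 m2.
have m4 := congr2 (fun a b => a - b) m1 m2.
have m5 := congr2 (fun a b => a + b) m4 m3.
by apply: (zmod_eq_by m5); zmodule.
Qed.

Let lieA0l xi : lieA 0 xi = 0. Proof. exact: lie0l. Qed.
Let lieA0r X : lieA X 0 = 0. Proof. exact: lie0r. Qed.
Let lieB0l X : lieB 0 X = 0. Proof. exact: (lie0l dual_sp). Qed.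
Let lieB0r xi : lieB xi 0 = 0. Proof. exact: (lie0r dual_sp). Qed.
Let dA0 : dA 0 = 0. Proof. exact: dsec0. Qed.
Let dB0 : dB 0 = 0. Proof. exact: (dsec0 dual_sp). Qed.

Lemma double_bracket_Al X Z : br (sec_pair X 0) Z =
  sec_pair (LA X (fst Z) + (dB <<X, snd Z>> - lieB (snd Z) X)) (lieA X (snd Z)).
Proof.
apply: double_ext; rewrite ?fst_br ?snd_br !sec_pairK.
  by rewrite lieB0l; zmodule.
by rewrite la_br0l lieA0r bsec0r dA0; zmodule.
Qed.

Lemma double_bracket_AA X Y :
  br (sec_pair X 0) (sec_pair Y 0) = sec_pair (LA X Y) 0.
Proof.
rewrite double_bracket_Al !sec_pairK bsec0r dB0 lieB0l lieA0r; congr sec_pair.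
by zmodule.
Qed.

Lemma double_bracket_BB xi eta :
  br (sec_pair 0 xi) (sec_pair 0 eta) = sec_pair 0 (LB xi eta).
Proof.
apply: double_ext; rewrite ?fst_br ?snd_br !sec_pairK.
  by rewrite la_br0l !lieB0r bsec0l dB0; zmodule.
by rewrite !lieA0l bsec0l dA0; zmodule.
Qed.

Local Notation J := (jacobiator br).

Lemma double_jacobi_AAA X Y Y' :
  J (sec_pair X 0) (sec_pair Y 0) (sec_pair Y' 0) = 0.
Proof.
have AA := double_bracket_AA; rewrite /jacobiator.
rewrite (AA Y Y') (AA X Y) (AA X Y') (AA X (LA Y Y')) (AA (LA X Y) Y').
rewrite (AA Y (LA X Y')) la_jacobi.
apply: double_ext.
  rewrite 2!fstD 2!fstN !sec_pairK1 fst0. zmodule.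
rewrite 2!sndD 2!sndN !sec_pairK2 snd0. zmodule.
Qed.

Lemma double_jacobi_BBB xi eta zeta :
  J (sec_pair 0 xi) (sec_pair 0 eta) (sec_pair 0 zeta) = 0.
Proof.
have BB := double_bracket_BB; rewrite /jacobiator.
rewrite (BB eta zeta) (BB xi eta) (BB xi zeta) (BB xi (LB eta zeta)).
rewrite (BB (LB xi eta) zeta) (BB eta (LB xi zeta)) la_jacobi.
apply: double_ext.
  rewrite 2!fstD 2!fstN !sec_pairK1 fst0. zmodule.
rewrite 2!sndD 2!sndN !sec_pairK2 snd0. zmodule.
Qed.

(** The A-component of the bracket of X with zeta is minus the contraction of
    d^B X by zeta.  Hence the jacobiator, paired with eta, is exactly the defect of
    [elb_compat] evaluated on (xi, eta). *)
Lemma double_jacobi_AABB X1 X2 xi eta :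
  q (J (sec_pair X1 0) (sec_pair X2 0) (sec_pair 0 xi)) (sec_pair 0 eta) = 0.
Proof.
have := elb_compat bialg X1 X2 (fun i => if i == ord0 then xi else eta).
have sw zeta X : bsec (bswap p) zeta X = <<X, zeta>> by [].
rewrite /lie_form !big_ord_recl !big_ord0 !dCE_form1 /upd /= !sw !actE => h.
have br_lie X Y zeta : <<LA X Y, zeta>> = rA X <<Y, zeta>> - <<Y, lieA X zeta>>.
  by rewrite pair_lieA; zmodule.
have alphaE X zeta zeta' : <<dB <<X, zeta>> - lieB zeta X, zeta'>> =
    rB zeta' <<X, zeta>> - rB zeta <<X, zeta'>> + <<X, LB zeta zeta'>>.
  by rewrite !bsecE pair_dB pair_lieB; zmodule.
rewrite /jacobiator double_bracket_AA !double_bracket_Al !sec_pairK.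
rewrite /q !sec_pairK bsec0l addr0.
rewrite !fstD !fstN !sec_pairK.
rewrite !la_br0r !add0r !bsecE.
rewrite [<<LA X1 (_ - _), _>>]br_lie [<<LA X2 (_ - _), _>>]br_lie !alphaE.
rewrite ?bsecE !pair_dB !pair_lieB !actE.
by apply: (zmod_eq_by h); zmodule.
Qed.

Lemma half_pairingE Z W : bsec (half_pairing p) Z W = 2^-1 *: q Z W.
Proof. exact: section_eqP. Qed.

Lemma act_sum_map Z u : act (sum_map rhoA rhoB) Z u = r Z u.
Proof. exact: section_eqP. Qed.

Lemma double_bracket_Leibniz Z1 Z2 Z3 :
  br Z1 (br Z2 Z3) = br (br Z1 Z2) Z3 + br Z2 (br Z1 Z3).
Proof.
have brDl W1 W2 W : br (W1 + W2) W = br W1 W + br W2 W.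
  by have := double_bracket_linearl W 1 W1 W2; rewrite !scale1r.
have brDr W W1 W2 : br W (W1 + W2) = br W W1 + br W W2.
  by have := double_bracket_linearr W 1 W1 W2; rewrite !scale1r.
have rD Z u v : r Z (u + v) = r Z u + r Z v.
  by rewrite /r !actDr; zmodule.
have splitAB Z : exists a b, [/\ exists X, a = sec_pair X 0,
    exists xi, b = sec_pair 0 xi & Z = a + b].
  exists (sec_pair (fst Z) 0), (sec_pair 0 (snd Z)); split; [by eexists|by eexists|].
  by apply: double_ext; rewrite ?fstD ?sndD !sec_pairK ?addr0 ?add0r.
suff /eqP : J Z1 Z2 Z3 = 0.
  by rewrite /jacobiator subr_eq0 subr_eq => /eqP ->; rewrite addrC.
apply: (jacobiator_zero double_pairingDl double_pairingC
  double_pairing_nondegenerate brDl brDr rD double_pairing_d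
  double_anchor_bracket double_anchor_pairing double_bracket_sym
  double_d_bracket splitAB).
- by move=> _ _ _ [X ->] [Y ->] [Y' ->]; exact: double_jacobi_AAA.
- by move=> _ _ _ [xi ->] [eta ->] [zeta ->]; exact: double_jacobi_BBB.
- by move=> _ _ _ _ [X ->] [Y ->] [xi ->] [eta ->]; exact: double_jacobi_AABB.
Qed.

Lemma double_rho_star m u (x : dsum A B m) :
  half_pairing p m (D u m) x = 2^-1 *: sum_map rhoA rhoB m x u.
Proof.
rewrite /= (bmap_dsec invA) addrC; congr (_ *: (_ + _)).
exact: (bmap_dsec invB).
Qed.

(** Testing against elements of B alone, and of A alone, separates the two
    components. *)
Lemma half_pairing_nondegenerate m (z : dsum A B m) :
  (forall w, half_pairing p m z w = 0) -> z = 0.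
Proof.
have half_neq0 : (2^-1 : R) != 0 by rewrite invr_eq0 pnatr_eq0.
have half0 (e : E m) : 2^-1 *: e = 0 -> e = 0.
  by move=> /eqP; rewrite scaler_eq0 (negPf half_neq0) => /eqP.
have [nd1 nd2] := dual_p; case: z => a b h; congr pair.
  by apply: nd1 => b'; have /half0 := h (0, b'); rewrite /= bmap0l addr0.
by apply: nd2 => a'; have /half0 := h (a', 0); rewrite /= bmap0r add0r.
Qed.

(** Every element of the jet fibre is the jet of some u, and (D u)(m) is the
    element of the double that represents it: the two axioms on jets become the
    description of D u by the pairing, and r (D u) = 0. *)
Lemma double_is_E_Courant :
  is_E_Courant (half_pairing p) br (sum_map rhoA rhoB).
Proof.
have starE m nu (k : dsum A B m) (u : section E) :
    (forall d, DE_fiber d -> nu d = d u) ->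
    is_rho_star (half_pairing p) (sum_map rhoA rhoB) nu k -> k = D u m.
  move=> nuE kE; apply/eqP; rewrite -subr_eq0; apply/eqP.
  apply: half_pairing_nondegenerate => w.
  have lin := bmap_linearl (half_pairing p) w (-1) (D u m) k.
  rewrite addrC -scaleN1r lin kE double_rho_star nuE ?scaleN1r ?addNr//.
  exact: dmap_fiber.
split.
- exact: double_bracket_linearl.
- exact: double_bracket_linearr.
- exact: double_bracket_Leibniz.
- by move=> m k k'; rewrite /= addrC.
- exact: half_pairing_nondegenerate.
- by move=> Z W u; rewrite !act_sum_map; exact: double_anchor_bracket.
- move=> Z m x; rewrite /jet half_pairingE.
  have -> : 2^-1 *: q Z Z = <<fst Z, snd Z>>.
    rewrite /q -mulr2n -[<<_, _>> *+ 2]scaler_nat scalerA.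
    by rewrite mulVf ?scale1r// (pnatr_eq0 R).
  have -> : br Z Z = D <<fst Z, snd Z>>.
    by apply: double_ext; rewrite ?fst_br ?snd_br !sec_pairK la_alt; zmodule.
  exact: double_rho_star.
- move=> Z W1 W2.
  rewrite act_sum_map !half_pairingE -scalerDr -double_anchor_pairing.
  by rewrite /r !actZr scalerDr.
- move=> m nu /JE_fiber_jet[u uE]; exists (D u m) => x.
  by rewrite double_rho_star uE//; exact: dmap_fiber.
- move=> m nu k /JE_fiber_jet[u uE] /(starE _ _ _ _ uE) ->.
  apply/funext => v.
  exact: (congr1 (fun s : section E => s m) (anchor_d u v)).
Qed.

End Double.

Theorem theorem7p4 (R : realType) (n : nat) (M : manifold R n)
    (E A B : vbundle M) (LA : lie_algebroid A) (LB : lie_algebroid B)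
    (p : bilmap A B E) (rhoA : demap A E) (rhoB : demap B E) :
  is_E_Lie_bialgebroid LA LB p rhoA rhoB ->
  is_E_Courant (half_pairing p) (double_bracket LA LB p rhoA rhoB)
    (sum_map rhoA rhoB).
Proof. exact: double_is_E_Courant. Qed.
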